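(* Let $\sigma(1)$ be the supremum of all real $\sigma$ such that $\zeta(\sigma+it)=1$ for some $t\in\mathbb{R}$. Then the equation $$\zeta(\sigma)=\frac{2^\sigma+1}{2^\sigma-1}$$ has a unique solution $\sigma>1$, and $\sigma(1)$ is equal to this solution. Numerically, $\sigma(1)=1.94010\,16837\,43625\,28601\,74693\,90525\,54887\,82302\,47607\dots$
   Context: $\zeta$ denotes the Riemann zeta function. *)

(* Defs.v *)
From Stdlib Require Export Reals.
From Coquelicot Require Export Coquelicot.
Open Scope R_scope.

Definition Cexp (z : C) : C :=
  (exp (fst z) * cos (snd z), exp (fst z) * sin (snd z)).

(** [n^(-s)], with the real logarithm of [n]; meant for [n >= 1]. *)
Definition nat_Cpow_opp (n : nat) (s : C) : C :=
  Cexp (Copp (Cmult s (RtoC (ln (INR n))))).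

(** [zeta] is the Riemann zeta function: the sum of the Dirichlet series
    [1^(-s) + 2^(-s) + ...] on [Re s > 1], continued holomorphically to [C]
    minus the point [1].  By the identity theorem these two conditions determine
    [zeta] at every [s <> 1]; its value at [1] is left unspecified. *)
Definition is_riemann_zeta (zeta : C -> C) : Prop :=
  (forall s : C, 1 < fst s ->
     @is_series C_AbsRing C_NormedModule
       (fun n : nat => nat_Cpow_opp (S n) s) (zeta s)) /\
  (forall s : C, s <> RtoC 1 -> @ex_derive C_AbsRing C_NormedModule zeta s).

(** The supremum, in the extended reals, of the real parts of the [a]-points of
    [zeta]; the pole [s = 1] is not in the domain of [zeta]. *)
Definition sigma_sup (zeta : C -> C) (a : C) : Rbar :=
  Lub_Rbar (fun sigma : R =>
    exists t : R, (sigma, t) <> RtoC 1 /\ zeta (sigma, t) = a).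

(* Main.v *)
Require Import Defs.
From Stdlib Require Import Lra Lia Psatz List Arith ZArith Classical Ranalysis5.
Import ListNotations.
Open Scope R_scope.

(** Separating even and odd [n] in the Dirichlet series gives, for [Re s > 1],
      [1 + sum_(m >= 1) (m + 1/2)^(-s) = (2^s - 1) (zeta s - 1)],
    so [zeta s = 1] means that this sum equals [-1].  On the real axis the sum is strictly
    decreasing and the equation of the theorem says that it equals [1]; call [sigma0] the
    solution.  By the triangle inequality no [1]-point has real part above [sigma0].

    Conversely, the logarithms of the primes are linearly independent over the rationals,
    so by Kronecker's theorem there is [t] with [2^(it)] close to [-1] and [p^(it)] close
    to [1] for all odd primes [p <= X].  Then [(m + 1/2)^(-it)] is close to [-1] for all
    small [m], and [1 + sum (m + 1/2)^(-s-it)] is close, together with its derivative, to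
    [1 - sum (m + 1/2)^(-s)], which has a simple zero at [sigma0]; Newton's iteration
    with frozen derivative then contracts to a zero near [sigma0 + it].

    Kronecker's theorem is obtained from the mean value of a product of Fejer kernels.
    The decimals come from the midpoint Euler-Maclaurin formula, whose error is controlled
    by telescoping, evaluated in fixed-point interval arithmetic. *)

(** * Kronecker's theorem for logarithms of primes *)

(** Halving is what makes a global sign available: each [m + 1/2] is an odd integer over exactly one
    factor 2, so moving the phase of 2 alone reverses every term at once while the odd primes stay
    put. The obstacle is that phases can be steered for finitely many terms only, whereas the Newton
    map involves the whole series and its derivative. Both errors are therefore dominated by one
    weighted sum of phase gaps with weight [(m + 3/2)^(-8/5)]: its tail is small because the weight
    is summable, its head by Kronecker. The weight absorbs two logarithmic factors and a
    displacement of at most 1/10, which asks for a lower bound 19/10 on the solution. Thus the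
    numerical enclosure feeds back into the existence proof: its endpoints bracket the solution for
    the intermediate value theorem and supply that margin. As to Kronecker: a product of Fejer
    kernels of order [n] has mean 1, and its mean against the total phase defect is the number of
    primes divided by [n + 1]; so the defect is small somewhere. *)

Definition has_mean (f : R -> R) (m : R) : Prop :=
  exists (Q : R -> R) (B : R),
    (forall t, is_derive Q t (f t)) /\ (forall t, Rabs (Q t - m * t) <= B).

Lemma has_mean_ext (f g : R -> R) (m m' : R) :
  (forall t, f t = g t) -> m = m' -> has_mean f m -> has_mean g m'.
Proof.
  intros Hfg <- (Q & B & HQ & HB). exists Q, B. split; [|exact HB].
  intros t. rewrite <- Hfg. apply HQ.
Qed.

Lemma has_mean_plus (f g : R -> R) (m m' : R) :
  has_mean f m -> has_mean g m' -> has_mean (fun t => f t + g t) (m + m').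
Proof.
  intros (Q & B & HQ & HB) (Q' & B' & HQ' & HB').
  exists (fun t => Q t + Q' t), (B + B'). split.
  - intros t. apply (is_derive_plus Q Q' t); auto.
  - intros t. specialize (HB t). specialize (HB' t).
    replace (Q t + Q' t - (m + m') * t) with ((Q t - m * t) + (Q' t - m' * t)) by ring.
    eapply Rle_trans; [apply Rabs_triang|lra].
Qed.

Lemma has_mean_scal (c : R) (f : R -> R) (m : R) :
  has_mean f m -> has_mean (fun t => c * f t) (c * m).
Proof.
  intros (Q & B & HQ & HB). exists (fun t => c * Q t), (Rabs c * B). split.
  - intros t. apply (is_derive_scal Q t c); auto.
  - intros t. replace (c * Q t - c * m * t) with (c * (Q t - m * t)) by ring.
    rewrite Rabs_mult. apply Rmult_le_compat_l; [apply Rabs_pos|apply HB].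
Qed.

Lemma has_mean_const (c : R) : has_mean (fun _ => c) c.
Proof.
  exists (fun t => c * t), 0. split.
  - intros t. auto_derive; [trivial|ring].
  - intros t. rewrite Rminus_diag, Rabs_R0. lra.
Qed.

Lemma has_mean_cos (w phi : R) : w <> 0 -> has_mean (fun t => cos (w * t + phi)) 0.
Proof.
  intros Hw. exists (fun t => sin (w * t + phi) / w), (/ Rabs w). split.
  - intros t. auto_derive; [trivial|]. field. exact Hw.
  - intros t. rewrite Rmult_0_l, Rminus_0_r. unfold Rdiv.
    rewrite Rabs_mult, Rabs_inv.
    rewrite <- (Rmult_1_l (/ Rabs w)) at 2.
    apply Rmult_le_compat_r.
    + left. apply Rinv_0_lt_compat, Rabs_pos_lt, Hw.
    + apply Rabs_le, SIN_bound.
Qed.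

(** A mean is encoded by a primitive within bounded distance of a line, a form closed under linear
    combinations and explicit for cosines. A negative slope would make the primitive decrease over a
    long interval, against the mean value theorem. *)
Lemma has_mean_ge0 (f : R -> R) (m : R) :
  (forall t, 0 <= f t) -> has_mean f m -> 0 <= m.
Proof.
  intros Hf (Q & B & HQ & HB).
  destruct (Rle_or_lt 0 m) as [H|H]; [exact H|exfalso].
  assert (HB0 : 0 <= B) by (eapply Rle_trans; [apply Rabs_pos|apply (HB 0)]).
  (* At this length the line has descended by [2 * B + 1], more than the two endpoint errors can
     compensate. *)
  set (T := (2 * B + 1) / - m).
  assert (HT : 0 < T) by (apply Rdiv_lt_0_compat; lra).
  destruct (MVT_gen Q 0 T f) as (c & _ & Hc).
  - intros x _. apply HQ.
  - intros x _. apply continuity_pt_filterlim.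
    apply (ex_derive_continuous (K := R_AbsRing) (V := R_NormedModule)).
    exists (f x). apply HQ.
  - assert (Q 0 <= Q T).
    { assert (0 <= f c * (T - 0)) by (apply Rmult_le_pos; [apply Hf|lra]). lra. }
    assert (m * T = - (2 * B + 1)) by (unfold T; field; lra).
    generalize (HB 0) (HB T). intros K0 K1.
    apply Rabs_le_between in K0. apply Rabs_le_between in K1. lra.
Qed.

Lemma has_mean_le (f g : R -> R) (m m' : R) :
  (forall t, f t <= g t) -> has_mean f m -> has_mean g m' -> m <= m'.
Proof.
  intros Hle Hf Hg.
  assert (H : 0 <= m' + -1 * m); [|lra].
  apply (has_mean_ge0 (fun t => g t + -1 * f t)).
  - intros t. specialize (Hle t). lra.
  - apply has_mean_plus; [exact Hg|]. apply has_mean_scal, Hf.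
Qed.

(** [f] is orthogonal to the oscillations [(a/b)^(it)] with [a/b <> 1] built from
    integers prime to [l]: this is what makes the mean of a product of functions
    attached to different primes equal to the product of the means. *)
Definition coprime_mean (l : list nat) (f : R -> R) (m : R) : Prop :=
  forall (a b : nat) (phi : R), (0 < a)%nat -> (0 < b)%nat ->
    (forall p, In p l -> Nat.gcd p a = 1%nat /\ Nat.gcd p b = 1%nat) ->
    has_mean (fun t => f t * cos ((ln (INR a) - ln (INR b)) * t + phi))
             (if Nat.eq_dec a b then m * cos phi else 0).

Lemma coprime_mean_ext (l : list nat) (f g : R -> R) (m m' : R) :
  (forall t, f t = g t) -> m = m' -> coprime_mean l f m -> coprime_mean l g m'.
Proof.
  intros Hfg <- Hf a b phi Ha Hb Hl.
  eapply has_mean_ext; [|reflexivity|exact (Hf a b phi Ha Hb Hl)].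
  intros t. cbv beta. now rewrite Hfg.
Qed.

Lemma coprime_mean_plus (l : list nat) (f g : R -> R) (m m' : R) :
  coprime_mean l f m -> coprime_mean l g m' ->
  coprime_mean l (fun t => f t + g t) (m + m').
Proof.
  intros Hf Hg a b phi Ha Hb Hl.
  eapply has_mean_ext;
    [| |exact (has_mean_plus _ _ _ _ (Hf a b phi Ha Hb Hl) (Hg a b phi Ha Hb Hl))].
  - intros t. cbv beta. ring.
  - destruct (Nat.eq_dec a b); ring.
Qed.

Lemma coprime_mean_scal (l : list nat) (c : R) (f : R -> R) (m : R) :
  coprime_mean l f m -> coprime_mean l (fun t => c * f t) (c * m).
Proof.
  intros Hf a b phi Ha Hb Hl.
  eapply has_mean_ext;
    [| |exact (has_mean_scal c _ _ (Hf a b phi Ha Hb Hl))].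
  - intros t. cbv beta. ring.
  - destruct (Nat.eq_dec a b); ring.
Qed.

Lemma coprime_mean_sum (l : list nat) (f : nat -> R -> R) (m : nat -> R) (n : nat) :
  (forall j, (j <= n)%nat -> coprime_mean l (f j) (m j)) ->
  coprime_mean l (fun t => sum_f_R0 (fun j => f j t) n) (sum_f_R0 m n).
Proof.
  induction n as [|n IH]; intros H; simpl.
  - apply H. lia.
  - apply (coprime_mean_plus l (fun t => sum_f_R0 (fun j => f j t) n)).
    + apply IH. intros j Hj. apply H. lia.
    + apply H. lia.
Qed.

Lemma ln_INR_inj (a b : nat) :
  (0 < a)%nat -> (0 < b)%nat -> ln (INR a) = ln (INR b) -> a = b.
Proof.
  intros Ha Hb H. apply INR_eq, ln_inv; [now apply lt_0_INR..|exact H].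
Qed.

Lemma coprime_mean_one : coprime_mean [] (fun _ => 1) 1.
Proof.
  intros a b phi Ha Hb _. destruct (Nat.eq_dec a b) as [->|Hab].
  - eapply has_mean_ext; [| |apply (has_mean_const (cos phi))].
    + intros t. cbv beta. rewrite Rminus_diag, Rmult_0_l, Rplus_0_l. ring.
    + ring.
  - eapply has_mean_ext;
      [| |apply (has_mean_cos (ln (INR a) - ln (INR b)) phi)]; try reflexivity.
    + intros t. cbv beta. ring.
    + intros H. apply Hab, ln_INR_inj; auto. lra.
Qed.

Lemma gcd_1_r (q : nat) : Nat.gcd q 1 = 1%nat.
Proof. apply Nat.divide_1_r, Nat.gcd_divide_r. Qed.

Lemma gcd_mul_r (q a b : nat) :
  Nat.gcd q a = 1%nat -> Nat.gcd q b = 1%nat -> Nat.gcd q (a * b) = 1%nat.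
Proof.
  intros Ha Hb. set (g := Nat.gcd q (a * b)).
  assert (Hgq : Nat.divide g q) by apply Nat.gcd_divide_l.
  apply Nat.divide_1_r. rewrite <- Hb. apply Nat.gcd_greatest; [exact Hgq|].
  apply (Nat.gauss g a b); [apply Nat.gcd_divide_r|].
  apply Nat.divide_1_r. rewrite <- Ha. apply Nat.gcd_greatest.
  - apply Nat.divide_trans with g; [apply Nat.gcd_divide_l|exact Hgq].
  - apply Nat.gcd_divide_r.
Qed.

Lemma gcd_pow_r (q p k : nat) : Nat.gcd q p = 1%nat -> Nat.gcd q (p ^ k) = 1%nat.
Proof.
  intros H. induction k as [|k IH]; simpl.
  - apply gcd_1_r.
  - now apply gcd_mul_r.
Qed.

(** Coprimality to [p] makes the exponent of [p] readable off the product; factors [p] are cancelled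
    one at a time until one side has none left. *)
Lemma coprime_mul_pow_inj (p a b j k : nat) : (1 < p)%nat ->
  (0 < a)%nat -> (0 < b)%nat -> Nat.gcd p a = 1%nat -> Nat.gcd p b = 1%nat ->
  (a * p ^ j = b * p ^ k)%nat -> a = b /\ j = k.
Proof.
  intros Hp Ha Hb Hpa Hpb. revert k.
  assert (Hno : forall c d e, Nat.gcd p c = 1%nat -> (c = d * p ^ S e)%nat -> False).
  { intros c d e Hc E.
    assert (D : Nat.divide p c) by (exists (d * p ^ e)%nat; simpl in E; lia).
    apply Nat.divide_gcd_iff in D; lia. }
  induction j as [|j IH]; intros [|k] E.
  - simpl in E. split; lia.
  - exfalso. apply (Hno a b k Hpa). simpl in *. lia.
  - exfalso. apply (Hno b a j Hpb). simpl in *. lia.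
  - destruct (IH k) as [-> ->]; [|auto].
    apply (proj1 (Nat.mul_cancel_l _ _ p ltac:(lia))). simpl in E. lia.
Qed.

Lemma ln_INR_mul_pow (a p k : nat) : (0 < a)%nat -> (0 < p)%nat ->
  ln (INR (a * p ^ k)) = ln (INR a) + INR k * ln (INR p).
Proof.
  intros Ha Hp. rewrite mult_INR, pow_INR, ln_mult.
  - now rewrite ln_pow by now apply lt_0_INR.
  - now apply lt_0_INR.
  - now apply pow_lt, lt_0_INR.
Qed.

(** The product formula turns the new cosine into two oscillations, along [a p^j / (b p^k)] and
    [a p^k / (b p^j)]. As [a] and [b] are prime to [p], either ratio is 1 only for [a = b] and
    [j = k]. This is where the independence of the logarithms of primes enters. *)
Lemma coprime_mean_cos (l : list nat) (f : R -> R) (m : R) (p j k : nat) (th : R) :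
  (1 < p)%nat -> (forall q, In q l -> Nat.gcd q p = 1%nat) ->
  coprime_mean l f m ->
  coprime_mean (p :: l)
    (fun t => f t * cos ((INR j - INR k) * (ln (INR p) * t - th)))
    (if Nat.eq_dec j k then m else 0).
Proof.
  intros Hp Hl Hf a b phi Ha Hb Hab.
  assert (Hpa : Nat.gcd p a = 1%nat /\ Nat.gcd p b = 1%nat) by (apply Hab; now left).
  destruct Hpa as [Hpa Hpb].
  assert (Hpos : forall c i, (0 < c)%nat -> (0 < c * p ^ i)%nat).
  { intros c i Hc. assert (p ^ i <> 0)%nat by (apply Nat.pow_nonzero; lia). nia. }
  assert (Hcop : forall i i' q, In q l ->
    Nat.gcd q (a * p ^ i) = 1%nat /\ Nat.gcd q (b * p ^ i') = 1%nat).
  { intros i i' q Hq. destruct (Hab q (or_intror Hq)).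
    split; apply gcd_mul_r; auto; apply gcd_pow_r; auto. }
  assert (H1 := Hf (a * p ^ j)%nat (b * p ^ k)%nat (phi - (INR j - INR k) * th)
    (Hpos _ _ Ha) (Hpos _ _ Hb) (Hcop j k)).
  assert (H2 := Hf (a * p ^ k)%nat (b * p ^ j)%nat (phi + (INR j - INR k) * th)
    (Hpos _ _ Ha) (Hpos _ _ Hb) (Hcop k j)).
  eapply has_mean_ext;
    [| |exact (has_mean_plus _ _ _ _ (has_mean_scal (/2) _ _ H1) (has_mean_scal (/2) _ _ H2))].
  - intros t. cbv beta. rewrite !ln_INR_mul_pow by lia.
    set (u := (INR j - INR k) * (ln (INR p) * t - th)).
    set (y := (ln (INR a) - ln (INR b)) * t + phi).
    replace ((ln (INR a) + INR j * ln (INR p) - (ln (INR b) + INR k * ln (INR p))) * t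
      + (phi - (INR j - INR k) * th)) with (y + u) by (unfold y, u; ring).
    replace ((ln (INR a) + INR k * ln (INR p) - (ln (INR b) + INR j * ln (INR p))) * t
      + (phi + (INR j - INR k) * th)) with (y - u) by (unfold y, u; ring).
    rewrite cos_plus, cos_minus. field.
  - destruct (Nat.eq_dec (a * p ^ j) (b * p ^ k)) as [E|E].
    + apply coprime_mul_pow_inj in E; auto. destruct E as [-> ->].
      destruct (Nat.eq_dec (b * p ^ k) (b * p ^ k)); [|congruence].
      destruct (Nat.eq_dec b b); [|congruence].
      destruct (Nat.eq_dec k k); [|congruence].
      rewrite Rminus_diag, Rmult_0_l, Rminus_0_r, Rplus_0_r. field.
    + destruct (Nat.eq_dec (a * p ^ k) (b * p ^ j)) as [E'|E'].
      * apply coprime_mul_pow_inj in E'; auto. destruct E' as [-> ->]. congruence.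
      * destruct (Nat.eq_dec a b) as [->|]; destruct (Nat.eq_dec j k) as [->|];
          try congruence; ring.
Qed.

(** * Fejer kernels and the simultaneous approximation of phases *)

Definition fejer (n : nat) (x : R) : R :=
  / INR (S n) * sum_f_R0 (fun j => sum_f_R0 (fun k => cos ((INR j - INR k) * x)) n) n.

(** The kernel is the squared modulus of [1 + e^(ix) + ... + e^(inx)] over [n + 1]. Positivity is
    read off from this form; the double sum of the definition is the form to which
    [coprime_mean_cos] applies termwise. *)
Lemma fejer_sum_sqr (n : nat) (x : R) :
  fejer n x = / INR (S n) *
    (Rsqr (sum_f_R0 (fun j => cos (INR j * x)) n) + Rsqr (sum_f_R0 (fun j => sin (INR j * x)) n)).
Proof.
  unfold fejer. f_equal.
  set (Cn := sum_f_R0 (fun j => cos (INR j * x)) n).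
  set (Sn := sum_f_R0 (fun j => sin (INR j * x)) n).
  transitivity (sum_f_R0 (fun j => cos (INR j * x) * Cn + sin (INR j * x) * Sn) n).
  - apply sum_eq. intros j _.
    rewrite (Rmult_comm _ Cn), (Rmult_comm _ Sn).
    unfold Cn, Sn. rewrite (Rmult_comm _ (cos (INR j * x))), (Rmult_comm _ (sin (INR j * x))).
    rewrite !scal_sum, <- sum_plus. apply sum_eq. intros k _.
    rewrite Rmult_minus_distr_r, cos_minus. ring.
  - rewrite sum_plus, <- !scal_sum with (x := Cn), <- !scal_sum with (x := Sn).
    reflexivity.
Qed.

Lemma fejer_ge0 (n : nat) (x : R) : 0 <= fejer n x.
Proof.
  rewrite fejer_sum_sqr. apply Rmult_le_pos.
  - left. apply Rinv_0_lt_compat, lt_0_INR. lia.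
  - apply Rplus_le_le_0_compat; apply Rle_0_sqr.
Qed.

(** The squared modulus of the geometric sum identity, whose real and imaginary parts are [H] below.
    It expresses that the kernel concentrates at phase 0. *)
Lemma fejer_mul (n : nat) (x : R) :
  fejer n x * (1 - cos x) = / INR (S n) * (1 - cos (INR (S n) * x)).
Proof.
  rewrite fejer_sum_sqr, Rmult_assoc. f_equal.
  assert (H : sum_f_R0 (fun j => cos (INR j * x)) n * (1 - cos x)
     + sum_f_R0 (fun j => sin (INR j * x)) n * sin x = 1 - cos (INR (S n) * x) /\
     sum_f_R0 (fun j => sin (INR j * x)) n * (1 - cos x)
     - sum_f_R0 (fun j => cos (INR j * x)) n * sin x = - sin (INR (S n) * x)).
  { induction n as [|n [IH1 IH2]].
    - simpl. rewrite Rmult_0_l, Rmult_1_l, cos_0, sin_0. split; ring.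
    - rewrite (S_INR (S n)), Rmult_plus_distr_r, Rmult_1_l, cos_plus, sin_plus.
      rewrite !tech5. split; lra. }
  destruct H as [H1 H2].
  revert H1 H2.
  generalize (sum_f_R0 (fun j => cos (INR j * x)) n) (sum_f_R0 (fun j => sin (INR j * x)) n).
  intros Cn Sn H1 H2.
  generalize (sin2_cos2 x) (sin2_cos2 (INR (S n) * x)). unfold Rsqr.
  intros E1 E2.
  assert (E : (Cn * (1 - cos x) + Sn * sin x) * (Cn * (1 - cos x) + Sn * sin x)
    + (Sn * (1 - cos x) - Cn * sin x) * (Sn * (1 - cos x) - Cn * sin x)
    = (Cn * Cn + Sn * Sn) * (1 - 2 * cos x + (sin x * sin x + cos x * cos x))) by ring.
  rewrite H1, H2, E1 in E. lra.
Qed.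

Lemma sum_f_R0_delta (n j : nat) (c : R) : (j <= n)%nat ->
  sum_f_R0 (fun k => if Nat.eq_dec j k then c else 0) n = c.
Proof.
  intros Hj.
  assert (Hout : forall i, (i < j)%nat ->
    sum_f_R0 (fun k => if Nat.eq_dec j k then c else 0) i = 0).
  { induction i; intros Hi; simpl; [|rewrite IHi by lia];
      destruct (Nat.eq_dec j _); try lia; lra. }
  induction n as [|n IH].
  - simpl. destruct (Nat.eq_dec j 0); [reflexivity|lia].
  - simpl. destruct (Nat.eq_dec j (S n)) as [->|].
    + rewrite Hout by lia. ring.
    + rewrite IH by lia. ring.
Qed.

(** Only the [n + 1] diagonal pairs [j = k] contribute, and the normalization [1 / (n + 1)] restores
    [m]. *)
Lemma coprime_mean_fejer (l : list nat) (f : R -> R) (m : R) (p n : nat) (th : R) :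
  (1 < p)%nat -> (forall q, In q l -> Nat.gcd q p = 1%nat) ->
  coprime_mean l f m ->
  coprime_mean (p :: l) (fun t => f t * fejer n (ln (INR p) * t - th)) m.
Proof.
  intros Hp Hl Hf.
  eapply coprime_mean_ext; [| |
    apply (coprime_mean_scal (p :: l) (/ INR (S n))
     (fun t => sum_f_R0 (fun j => sum_f_R0 (fun k =>
        f t * cos ((INR j - INR k) * (ln (INR p) * t - th))) n) n)
     (sum_f_R0 (fun j => sum_f_R0 (fun k => if Nat.eq_dec j k then m else 0) n) n))].
  - intros t. cbv beta. unfold fejer.
    rewrite (Rmult_comm (f t)), Rmult_assoc. f_equal.
    rewrite (Rmult_comm _ (f t)), scal_sum. apply sum_eq. intros j _.
    rewrite (Rmult_comm _ (f t)), scal_sum. apply sum_eq. intros k _. ring.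
  - rewrite (sum_eq _ (fun _ => m)).
    + rewrite sum_cte. field. apply not_0_INR. lia.
    + intros j Hj. now apply sum_f_R0_delta.
  - apply (coprime_mean_sum _
      (fun j t => sum_f_R0 (fun k => f t * cos ((INR j - INR k) * (ln (INR p) * t - th))) n)
      (fun j => sum_f_R0 (fun k => if Nat.eq_dec j k then m else 0) n)). intros j _.
    apply (coprime_mean_sum _
      (fun k t => f t * cos ((INR j - INR k) * (ln (INR p) * t - th)))
      (fun k => if Nat.eq_dec j k then m else 0)). intros k _.
    now apply coprime_mean_cos.
Qed.

Definition fejer_prod (n : nat) (th : nat -> R) (l : list nat) (t : R) : R :=
  fold_right (fun p y => y * fejer n (ln (INR p) * t - th p)) 1 l.

Definition phase_defect (th : nat -> R) (l : list nat) (t : R) : R :=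
  fold_right (fun p y => y + (1 - cos (ln (INR p) * t - th p))) 0 l.

Lemma fejer_prod_ge0 (n : nat) (th : nat -> R) (l : list nat) (t : R) :
  0 <= fejer_prod n th l t.
Proof.
  induction l as [|p l IH]; simpl; [lra|].
  apply Rmult_le_pos; [exact IH|apply fejer_ge0].
Qed.

(** A new prime adds [1 - cos x] to the defect, and [fejer_mul] converts its product with the kernel
    to [(1 - cos ((n + 1) x)) / (n + 1)]. The oscillating part has mean 0, so each prime contributes
    exactly [1 / (n + 1)]. *)
Lemma coprime_mean_fejer_prod (n : nat) (th : nat -> R) (l : list nat) :
  (forall p, In p l -> (1 < p)%nat) ->
  ForallOrdPairs (fun p q => Nat.gcd p q = 1%nat) l ->
  coprime_mean l (fejer_prod n th l) 1 /\
  coprime_mean l (fun t => fejer_prod n th l t * phase_defect th l t)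
    (INR (length l) / INR (S n)).
Proof.
  intros H1 Hl. induction Hl as [|p l Hp Hl IH].
  - split; [apply coprime_mean_one|].
    eapply coprime_mean_ext; [| |apply (coprime_mean_scal [] 0), coprime_mean_one].
    + intros t. simpl. ring.
    + simpl. unfold Rdiv. ring.
  - destruct IH as [IH1 IH2]; [intros q Hq; apply H1; now right|].
    assert (Hp1 : (1 < p)%nat) by (apply H1; now left).
    assert (Hq : forall q, In q l -> Nat.gcd q p = 1%nat).
    { intros q Hq. rewrite Nat.gcd_comm. rewrite Forall_forall in Hp. now apply Hp. }
    split; [now apply (coprime_mean_fejer l)|].
    assert (A1 := coprime_mean_fejer _ _ _ p n (th p) Hp1 Hq IH2).
    (* For [j = k = 0] the cosine is the constant 1, for [j = n + 1] and [k = 0] it is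
       [cos ((n + 1) x)]: the two pieces of [fejer_mul]. *)
    assert (A2 := coprime_mean_cos _ _ _ p 0 0 (th p) Hp1 Hq IH1).
    assert (A3 := coprime_mean_cos _ _ _ p (S n) 0 (th p) Hp1 Hq IH1).
    eapply coprime_mean_ext; [| |
      exact (coprime_mean_plus _ _ _ _ _ A1 (coprime_mean_scal _ (/ INR (S n)) _ _
       (coprime_mean_plus _ _ _ _ _ A2 (coprime_mean_scal _ (-1) _ _ A3))))].
    + intros t. cbv beta. cbn [fejer_prod phase_defect fold_right].
      fold (fejer_prod n th l t). fold (phase_defect th l t).
      set (x := ln (INR p) * t - th p).
      replace ((INR 0 - INR 0) * x) with 0 by (simpl; ring).
      replace ((INR (S n) - INR 0) * x) with (INR (S n) * x) by (simpl; ring).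
      rewrite cos_0. set (F := fejer_prod n th l t). set (D := phase_defect th l t).
      transitivity (F * D * fejer n x + F * (fejer n x * (1 - cos x))); [|ring].
      rewrite fejer_mul. ring.
    + cbn [Nat.eq_dec nat_rec nat_rect length].
      rewrite (S_INR (length l)). field. apply not_0_INR. lia.
Qed.

Theorem kronecker_log (th : nat -> R) (l : list nat) (eps : R) :
  (forall p, In p l -> (1 < p)%nat) ->
  ForallOrdPairs (fun p q => Nat.gcd p q = 1%nat) l -> 0 < eps ->
  exists t, forall p, In p l -> 1 - cos (ln (INR p) * t - th p) < eps.
Proof.
  intros H1 Hl Heps.
  assert (E : exists t, phase_defect th l t < eps).
  { apply NNPP. intros Hn.
    (* For this [n] the mean defect [length l / (n + 1)] is below [eps], while a defect of at least
       [eps] everywhere would force its mean up to [eps]. *)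
    destruct (INR_unbounded (INR (length l) / eps)) as [n Hn'].
    destruct (coprime_mean_fejer_prod n th l H1 Hl) as [M1 M2].
    assert (Hc : forall p, In p l -> Nat.gcd p 1 = 1%nat /\ Nat.gcd p 1 = 1%nat)
      by (intros; rewrite gcd_1_r; auto).
    assert (N1 := M1 1%nat 1%nat 0 ltac:(lia) ltac:(lia) Hc).
    assert (N2 := M2 1%nat 1%nat 0 ltac:(lia) ltac:(lia) Hc).
    destruct (Nat.eq_dec 1 1) as [_|]; [|congruence].
    rewrite cos_0 in N1, N2.
    assert (Hle : eps * (1 * 1) <= INR (length l) / INR (S n) * 1).
    { eapply has_mean_le; [|apply (has_mean_scal eps _ _ N1)|exact N2].
      intros t. cbv beta. rewrite Rminus_diag, Rmult_0_l, Rplus_0_l, cos_0.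
      assert (eps <= phase_defect th l t).
      { destruct (Rle_or_lt eps (phase_defect th l t)); auto. exfalso. apply Hn. now exists t. }
      generalize (fejer_prod_ge0 n th l t). nra. }
    assert (HS : 0 < INR (S n)) by (apply lt_0_INR; lia).
    rewrite S_INR in HS, Hle.
    assert (INR (length l) = INR (length l) / eps * eps) by (field; lra).
    assert (INR (length l) / (INR n + 1) * (INR n + 1) = INR (length l)) by (field; lra).
    nra. }
  destruct E as [t Ht]. exists t.
  assert (Hpd : forall l', 0 <= phase_defect th l' t).
  { induction l' as [|q l' IH']; simpl; [lra|].
    generalize (COS_bound (ln (INR q) * t - th q)). lra. }
  clear H1 Hl. induction l as [|q l IH]; intros p Hp; simpl in *; [tauto|].
  generalize (COS_bound (ln (INR q) * t - th q)) (Hpd l). intros Hb Hd.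
  fold (phase_defect th l t) in Ht.
  destruct Hp as [->|Hp]; [lra|]. apply IH; auto. lra.
Qed.

(** * From primes to odd integers *)

Definition nat_prime (p : nat) : Prop :=
  (1 < p)%nat /\ forall d, Nat.divide d p -> d = 1%nat \/ d = p.

Lemma nat_prime_gcd (p q : nat) :
  nat_prime p -> nat_prime q -> p <> q -> Nat.gcd p q = 1%nat.
Proof.
  intros [Hp Hp'] [Hq Hq'] Hpq.
  destruct (Hp' _ (Nat.gcd_divide_l p q)) as [E|E]; [exact E|].
  destruct (Hq' _ (Nat.gcd_divide_r p q)) as [E'|E']; congruence.
Qed.

Lemma nat_prime_divisor (n : nat) :
  (1 < n)%nat -> exists p, nat_prime p /\ Nat.divide p n.
Proof.
  induction n as [n IH] using lt_wf_ind. intros Hn.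
  destruct (classic (nat_prime n)) as [H|H].
  - exists n. split; [exact H|apply Nat.divide_refl].
  - assert (E : exists d, Nat.divide d n /\ d <> 1%nat /\ d <> n).
    { apply NNPP. intros Hno. apply H. split; [exact Hn|].
      intros d Hd. apply NNPP. intros Hd'. apply Hno. exists d. tauto. }
    destruct E as (d & Hd & Hd1 & Hdn).
    assert (d <= n)%nat by (apply Nat.divide_pos_le; [lia|exact Hd]).
    assert (d <> 0)%nat by (intros ->; apply Nat.divide_0_l in Hd; lia).
    destruct (IH d) as (p & Hp & Hpd); [lia..|].
    exists p. split; [exact Hp|]. now apply Nat.divide_trans with d.
Qed.

Lemma prime_list (X : nat) : exists l : list nat,
  ForallOrdPairs (fun p q => Nat.gcd p q = 1%nat) l /\
  (forall p, In p l <-> nat_prime p /\ (p <= X)%nat).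
Proof.
  induction X as [|X (l & Hl & Hin)].
  - exists []. split; [constructor|]. intros p. split; [intros []|].
    intros [[Hp _] Hp']. lia.
  - destruct (classic (nat_prime (S X))) as [HX|HX].
    + exists (S X :: l). split.
      * constructor; [|exact Hl]. apply Forall_forall. intros q Hq.
        apply Hin in Hq. apply nat_prime_gcd; [exact HX|tauto|lia].
      * intros p. simpl. rewrite Hin. split.
        -- intros [<-|[H1 H2]]; split; auto.
        -- intros [H1 H2]. destruct (Nat.eq_dec p (S X)) as [->|]; [now left|].
           right. split; [exact H1|lia].
    + exists l. split; [exact Hl|]. intros p. rewrite Hin. split.
      * intros [H1 H2]; split; auto.
      * intros [H1 H2]. split; [exact H1|].
        destruct (Nat.eq_dec p (S X)) as [->|]; [contradiction|lia].
Qed.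

(** Closeness of [x] to a multiple of [2 * PI], expressed without choosing the multiple. *)
Definition near_zero_phase (x e : R) : Prop := 1 - cos x <= e /\ Rabs (sin x) <= e.

Lemma near_zero_phase_add (x y e e' : R) :
  near_zero_phase x e -> near_zero_phase y e' -> near_zero_phase (x + y) (e + 2 * e').
Proof.
  intros [H1 H2] [H3 H4].
  assert (B1 := COS_bound x). assert (B2 := COS_bound y). assert (B3 := SIN_bound x).
  apply Rabs_le_between in H2. apply Rabs_le_between in H4.
  unfold near_zero_phase. rewrite cos_plus, sin_plus, Rabs_le_between.
  repeat split; nra.
Qed.

(** The threshold [e^2 / 2] comes from [sin^2 = (1 - cos) (1 + cos) <= 2 (1 - cos)]. *)
Lemma near_zero_phase_of_cos (x e : R) :
  0 < e <= 1 -> 1 - cos x < e * e / 2 -> near_zero_phase x e.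
Proof.
  intros He Hx. split; [nra|].
  assert (B := COS_bound x). assert (E := sin2_cos2 x). unfold Rsqr in E.
  apply Rabs_le_between. nra.
Qed.

(** Splitting [n = m p] costs [e + 2 m e], and [1 + 2 m <= m p] because an odd prime is at least 3;
    hence the error grows only linearly in [n]. *)
Lemma near_zero_phase_odd (t e : R) (X : nat) : 0 <= e ->
  (forall p, nat_prime p -> p <> 2%nat -> (p <= X)%nat -> near_zero_phase (ln (INR p) * t) e) ->
  forall n, Nat.Odd n -> (n <= X)%nat -> near_zero_phase (ln (INR n) * t) (INR n * e).
Proof.
  intros He Hp n. induction n as [n IH] using lt_wf_ind. intros Hn HnX.
  destruct (Nat.eq_dec n 1) as [->|Hn1].
  - simpl. rewrite ln_1, Rmult_0_l. split; [rewrite cos_0|rewrite sin_0, Rabs_R0]; lra.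
  - destruct Hn as [i Hi].
    destruct (nat_prime_divisor n) as (p & Hpp & m & Hm); [lia|].
    assert (Hp1 := proj1 Hpp).
    assert (Hmo : Nat.Odd m).
    { destruct (Nat.Even_or_Odd m) as [[j Hj]|H]; [|exact H]. exfalso. subst m. lia. }
    assert (p <> 2)%nat by (intros ->; lia).
    assert (Hm0 : (1 <= m)%nat) by (destruct Hmo; lia).
    assert (near_zero_phase (ln (INR p) * t) e) by (apply Hp; auto; nia).
    assert (near_zero_phase (ln (INR m) * t) (INR m * e)) by (apply IH; auto; nia).
    replace (ln (INR n) * t) with (ln (INR p) * t + ln (INR m) * t).
    + destruct (near_zero_phase_add _ _ _ _ H0 H1) as [A1 A2].
      assert (e + 2 * (INR m * e) <= INR n * e).
      { rewrite Hm, mult_INR.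
        assert (1 <= INR m) by (apply (le_INR 1); exact Hm0).
        assert (3 <= INR p) by (replace 3 with (INR 3) by (simpl; ring); apply le_INR; lia).
        assert (1 + 2 * INR m <= INR m * INR p) by nra. nra. }
      split; lra.
    + rewrite Hm, mult_INR, ln_mult; [ring|apply lt_0_INR; lia..].
Qed.

Lemma odd_phases_near_pi (X : nat) (eps : R) : 0 < eps ->
  exists t, forall n, Nat.Odd n -> (n <= X)%nat ->
    Rabs (cos ((ln (INR n) - ln 2) * t) + 1) <= eps /\
    Rabs (sin ((ln (INR n) - ln 2) * t)) <= eps.
Proof.
  intros Heps.
  assert (HX0 : 0 <= INR X) by apply pos_INR.
  (* The final error is [n e + 2 e], the second term coming from the phase of 2; hence the divisor
     [X + 2]. *)
  set (e := Rmin 1 (eps / (INR X + 2))).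
  assert (He : 0 < e <= 1).
  { split; [|apply Rmin_l]. apply Rmin_glb_lt; [lra|]. apply Rdiv_lt_0_compat; lra. }
  assert (He' : e * (INR X + 2) <= eps).
  { apply Rle_trans with (eps / (INR X + 2) * (INR X + 2)).
    - apply Rmult_le_compat_r; [lra|apply Rmin_r].
    - right. field. lra. }
  (* The bound [X + 2] puts 2 into the list even when [X] is below 2. *)
  destruct (prime_list (X + 2)) as (l & Hl & Hin).
  destruct (kronecker_log (fun p => if Nat.eq_dec p 2 then PI else 0) l (e * e / 2))
    as [t Ht]; [|exact Hl|nra|].
  { intros p Hp. apply Hin in Hp. apply (proj1 Hp). }
  exists t. intros n Hn HnX.
  assert (H2 : near_zero_phase (ln 2 * t - PI) e).
  { apply near_zero_phase_of_cos; [exact He|]. apply (Ht 2%nat), Hin.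
    split; [|lia]. split; [lia|]. intros d Hd.
    assert (d <= 2)%nat by (apply Nat.divide_pos_le; [lia|exact Hd]).
    assert (d <> 0)%nat by (intros ->; apply Nat.divide_0_l in Hd; lia). lia. }
  assert (Hodd : near_zero_phase (ln (INR n) * t) (INR n * e)).
  { apply (near_zero_phase_odd t e X); auto; [lra|]. intros p Hp Hp2 HpX.
    apply near_zero_phase_of_cos; [exact He|].
    specialize (Ht p). destruct (Nat.eq_dec p 2); [contradiction|].
    rewrite Rminus_0_r in Ht. apply Ht, Hin. split; [exact Hp|lia]. }
  assert (H2' : near_zero_phase (- (ln 2 * t - PI)) e).
  { destruct H2. split; [rewrite cos_neg|rewrite sin_neg, Rabs_Ropp]; auto. }
  destruct (near_zero_phase_add _ _ _ _ Hodd H2') as [A1 A2].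
  assert (INR n <= INR X) by (apply le_INR; exact HnX).
  replace ((ln (INR n) - ln 2) * t)
    with (ln (INR n) * t + - (ln 2 * t - PI) - PI) by ring.
  set (x := ln (INR n) * t + - (ln 2 * t - PI)) in *.
  rewrite cos_minus, sin_minus, cos_PI, sin_PI.
  assert (B := COS_bound x).
  replace (sin x * -1 - cos x * 0) with (- sin x) by ring. rewrite Rabs_Ropp.
  rewrite Rabs_pos_eq by lra. split; nra.
Qed.

(** * The Dirichlet series over half-integers *)

Lemma Cexp_plus (z w : C) : Cexp (Cplus z w) = Cmult (Cexp z) (Cexp w).
Proof.
  destruct z as [a b], w as [c d]. unfold Cexp, Cplus, Cmult; simpl.
  rewrite exp_plus, cos_plus, sin_plus. f_equal; ring.
Qed.

Lemma Cexp_0 : Cexp (RtoC 0) = RtoC 1.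
Proof. unfold Cexp, RtoC; simpl. rewrite exp_0, cos_0, sin_0. f_equal; ring. Qed.

Lemma is_series_C_fst (a : nat -> C) (l : C) :
  @is_series C_AbsRing C_NormedModule a l -> is_series (fun n => fst (a n)) (fst l).
Proof.
  intros H. unfold is_series.
  apply (filterlim_ext (fun n => fst (sum_n (G := C_AbelianMonoid) a n))).
  - induction x as [|n IH]; [now rewrite !sum_O|].
    rewrite !sum_Sn, <- IH. reflexivity.
  - eapply filterlim_comp; [exact H|].
    destruct l as [x y]. apply (continuous_fst (U := R_UniformSpace) (V := R_UniformSpace) x y).
Qed.

Lemma is_series_C_snd (a : nat -> C) (l : C) :
  @is_series C_AbsRing C_NormedModule a l -> is_series (fun n => snd (a n)) (snd l).
Proof.
  intros H. unfold is_series.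
  apply (filterlim_ext (fun n => snd (sum_n (G := C_AbelianMonoid) a n))).
  - induction x as [|n IH]; [now rewrite !sum_O|].
    rewrite !sum_Sn, <- IH. reflexivity.
  - eapply filterlim_comp; [exact H|].
    destruct l as [x y]. apply (continuous_snd (U := R_UniformSpace) (V := R_UniformSpace) x y).
Qed.

Lemma nat_Cpow_opp_mult (j k : nat) (s : C) : (0 < j)%nat -> (0 < k)%nat ->
  nat_Cpow_opp (j * k) s = Cmult (nat_Cpow_opp j s) (nat_Cpow_opp k s).
Proof.
  intros Hj Hk. unfold nat_Cpow_opp.
  rewrite mult_INR, ln_mult by now apply lt_0_INR.
  rewrite <- Cexp_plus. f_equal. rewrite RtoC_plus. ring.
Qed.

(** The even terms are [2^(-s)] times the whole series. The identity [E] holds exactly between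
    partial sums, the odd terms up to index [M] being matched with the full sums up to [2 M + 1] and
    [M], and then passes to the limit. *)
Lemma is_series_odd (zeta : C -> C) (s : C) : is_riemann_zeta zeta -> 1 < fst s ->
  @is_series C_AbsRing C_NormedModule (fun m => nat_Cpow_opp (2 * m + 1) s)
    (Cminus (zeta s) (Cmult (nat_Cpow_opp 2 s) (zeta s))).
Proof.
  intros [Hz _] Hs. specialize (Hz s Hs).
  set (a := fun n => nat_Cpow_opp (S n) s) in *.
  assert (E : forall M, sum_n (G := C_AbelianMonoid) (fun m => nat_Cpow_opp (2 * m + 1) s) M
    = Cminus (sum_n (G := C_AbelianMonoid) a (2 * M + 1))
       (Cmult (nat_Cpow_opp 2 s) (sum_n (G := C_AbelianMonoid) a M))).
  { assert (Ha : forall m, nat_Cpow_opp (2 * m + 1) s = a (2 * m)%nat).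
    { intros m. unfold a. f_equal. lia. }
    assert (Ha' : forall m, Cmult (nat_Cpow_opp 2 s) (a m) = a (2 * m + 1)%nat).
    { intros m. unfold a. rewrite <- nat_Cpow_opp_mult by lia. f_equal. lia. }
    induction M as [|M IH].
    - simpl (2 * 0 + 1)%nat. rewrite sum_Sn, !sum_O, Ha, Ha'.
      change plus with Cplus. simpl. ring.
    - replace (2 * S M + 1)%nat with (S (S (2 * M + 1))) by lia.
      rewrite !sum_Sn, IH, Ha. change plus with Cplus.
      rewrite Cmult_plus_distr_l, Ha'.
      replace (2 * S M)%nat with (S (2 * M + 1)) by lia.
      replace (S (2 * M + 1) + 1)%nat with (S (S (2 * M + 1))) by lia.
      match goal with |- @eq _ ?x ?y => change (@eq C x y) end. ring. }
  unfold is_series.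
  eapply filterlim_ext; [intros M; symmetry; apply E|].
  apply (filterlim_comp_2 (G := locally (T := C_UniformSpace) (zeta s))
    (H := locally (T := C_UniformSpace) (Copp (Cmult (nat_Cpow_opp 2 s) (zeta s))))
    (fun M => sum_n (G := C_AbelianMonoid) a (2 * M + 1))
    (fun M => Copp (Cmult (nat_Cpow_opp 2 s) (sum_n (G := C_AbelianMonoid) a M))) Cplus).
  - eapply filterlim_comp; [|exact Hz].
    intros P [N HN]. exists N. intros n Hn. apply HN. lia.
  - eapply filterlim_comp; [|apply (filterlim_opp (K := C_AbsRing) (V := C_NormedModule))].
    eapply filterlim_comp; [exact Hz|].
    apply (filterlim_scal_r (K := C_AbsRing) (V := C_NormedModule) (nat_Cpow_opp 2 s) (zeta s)).
  - apply (filterlim_plus (K := C_AbsRing) (V := C_NormedModule) (zeta s)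
        (Copp (Cmult (nat_Cpow_opp 2 s) (zeta s)))).
Qed.

(** The index is shifted so that [m = 0] gives 3/2, the first half-integer above 1; all these
    logarithms are then positive. *)
Definition half_ln (m : nat) : R := ln (INR m + 3 / 2).

Lemma half_ln_gt0 (m : nat) : 0 < half_ln m.
Proof.
  unfold half_ln. rewrite <- ln_1. apply ln_increasing; [lra|].
  assert (H := pos_INR m). lra.
Qed.

Lemma half_ln_odd (m : nat) : half_ln m = ln (INR (2 * S m + 1)) - ln 2.
Proof.
  unfold half_ln. rewrite <- ln_div; [|apply lt_0_INR; lia|lra].
  f_equal. rewrite plus_INR, mult_INR, (S_INR m). simpl (INR 2). simpl (INR 1). field.
Qed.

(** Dropping the first term 1 of the odd series and multiplying by [2^s] leaves
    [2^s zeta - zeta - 2^s], which equals [(2^s - 1) (zeta - 1) - 1]. *)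
Lemma is_series_half (zeta : C -> C) (s : C) : is_riemann_zeta zeta -> 1 < fst s ->
  @is_series C_AbsRing C_NormedModule (fun m => Cexp (Copp (Cmult s (RtoC (half_ln m)))))
    (Cminus (Cmult (Cminus (Cexp (Cmult s (RtoC (ln 2)))) (RtoC 1)) (Cminus (zeta s) (RtoC 1)))
       (RtoC 1)).
Proof.
  intros Hz Hs. assert (H := is_series_odd zeta s Hz Hs).
  set (u := Cexp (Cmult s (RtoC (ln 2)))).
  assert (Hu : Cmult u (nat_Cpow_opp 2 s) = RtoC 1).
  { unfold u, nat_Cpow_opp. rewrite <- Cexp_plus, <- Cexp_0. f_equal. simpl (INR 2).
    replace (1 + 1) with 2 by ring. ring. }
  apply (is_series_ext (fun m => Cmult u (nat_Cpow_opp (2 * S m + 1) s))).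
  { intros m. unfold u, nat_Cpow_opp. rewrite <- Cexp_plus, half_ln_odd. f_equal.
    rewrite RtoC_minus. ring. }
  replace (Cminus (Cmult (Cminus u (RtoC 1)) (Cminus (zeta s) (RtoC 1))) (RtoC 1))
    with (Cmult u (Cminus (Cminus (zeta s) (Cmult (nat_Cpow_opp 2 s) (zeta s))) (RtoC 1))).
  - apply (is_series_scal (K := C_AbsRing) (V := C_NormedModule) u).
    apply (is_series_incr_1 (K := C_AbsRing) (V := C_NormedModule)
      (fun m => nat_Cpow_opp (2 * m + 1) s)).
    match goal with |- is_series _ ?l =>
      replace l with (Cminus (zeta s) (Cmult (nat_Cpow_opp 2 s) (zeta s))); [exact H|] end.
    change plus with Cplus. simpl (2 * 0 + 1)%nat.
    replace (nat_Cpow_opp 1 s) with (RtoC 1); [ring|].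
    unfold nat_Cpow_opp. simpl. rewrite ln_1, <- Cexp_0. f_equal. ring.
  - transitivity (Cminus (Cminus (Cmult u (zeta s))
      (Cmult (Cmult u (nat_Cpow_opp 2 s)) (zeta s))) u); [ring|].
    rewrite Hu. ring.
Qed.

(** * Existence of [1]-points near [sigma0] *)

Lemma is_lim_seq_Rabs_0_unique (u : nat -> R) (a : R) :
  (forall n, Rabs a <= u n) -> is_lim_seq u 0 -> a = 0.
Proof.
  intros Hu Hl.
  assert (H : Rbar_le (Rabs a) 0) by (eapply is_lim_seq_le; [exact Hu|apply is_lim_seq_const|exact Hl]).
  simpl in H. assert (H' := Rabs_pos a).
  destruct (Req_dec a 0) as [E|E]; [exact E|]. apply Rabs_pos_lt in E. lra.
Qed.

Lemma ex_lim_seq_geom (u : nat -> R) (r : R) :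
  (forall n, Rabs (u (S n) - u n) <= r * (/ 2) ^ n) -> exists l : R, is_lim_seq u l.
Proof.
  intros Hu.
  assert (E : ex_series (fun n => u (S n) - u n)).
  { apply (ex_series_le (K := R_AbsRing) (V := R_CompleteNormedModule) _ (fun n => r * (/ 2) ^ n)).
    - exact Hu.
    - apply (ex_series_scal (K := R_AbsRing) (V := R_NormedModule) r).
      apply ex_series_geom. rewrite Rabs_pos_eq; lra. }
  destruct E as [l Hl]. exists (l + u 0%nat).
  apply is_lim_seq_incr_1.
  apply (is_lim_seq_ext (fun n => sum_n (fun n => u (S n) - u n) n + u 0%nat)).
  - induction n as [|n IH]; [rewrite sum_O; ring|].
    rewrite sum_Sn. change plus with Rplus. lra.
  - apply (is_lim_seq_plus' _ _ l (u 0%nat)); [exact Hl|apply is_lim_seq_const].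
Qed.

(** Banach's argument in the plane with the norm [|x| + |y|]. The steps from the origin are at most
    [r / 2^(n + 1)], so the iteration never leaves the ball on which the contraction is assumed. *)
Lemma contraction_fixed_point (f g : R -> R -> R) (r : R) :
  (forall x y x' y', Rabs x + Rabs y <= r -> Rabs x' + Rabs y' <= r ->
     Rabs (f x y - f x' y') + Rabs (g x y - g x' y') <= / 2 * (Rabs (x - x') + Rabs (y - y'))) ->
  Rabs (f 0 0) + Rabs (g 0 0) <= r / 2 ->
  exists x y, Rabs x + Rabs y <= r /\ f x y = x /\ g x y = y.
Proof.
  intros Hlip H0.
  set (z := fix z n := match n with
                       | O => (0, 0)
                       | S n => (f (fst (z n)) (snd (z n)), g (fst (z n)) (snd (z n)))
                       end).
  set (u := fun n => fst (z n)). set (v := fun n => snd (z n)).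
  assert (Hr : 0 <= r) by (assert (A := Rabs_pos (f 0 0)); assert (B := Rabs_pos (g 0 0)); lra).
  assert (Hpow : forall n, 0 < (/ 2) ^ n) by (intros n; apply pow_lt; lra).
  assert (Hz : forall n, Rabs (u n) + Rabs (v n) <= r * (1 - (/ 2) ^ n) /\
     Rabs (u (S n) - u n) + Rabs (v (S n) - v n) <= r / 2 * (/ 2) ^ n).
  { induction n as [|n [IH1 IH2]].
    - unfold u, v; simpl. rewrite !Rminus_0_r, Rabs_R0. split; lra.
    - assert (Hn1 : Rabs (u (S n)) + Rabs (v (S n)) <= r * (1 - (/ 2) ^ S n)).
      { assert (A := Rabs_triang (u n) (u (S n) - u n)).
        assert (B := Rabs_triang (v n) (v (S n) - v n)).
        replace (u n + (u (S n) - u n)) with (u (S n)) in A by ring.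
        replace (v n + (v (S n) - v n)) with (v (S n)) in B by ring.
        simpl pow. lra. }
      split; [exact Hn1|].
      assert (Hn := Hpow n). assert (Hn' := Hpow (S n)).
      eapply Rle_trans; [apply (Hlip (u (S n)) (v (S n)) (u n) (v n)); nra|].
      simpl pow. lra. }
  destruct (ex_lim_seq_geom u (r / 2)) as [x Hx].
  { intros n. assert (A := Rabs_pos (v (S n) - v n)). specialize (Hz n). lra. }
  destruct (ex_lim_seq_geom v (r / 2)) as [y Hy].
  { intros n. assert (A := Rabs_pos (u (S n) - u n)). specialize (Hz n). lra. }
  assert (Hxy : Rabs x + Rabs y <= r).
  { assert (H : Rbar_le (Rabs x + Rabs y) r); [|exact H].
    apply (is_lim_seq_le (fun n => Rabs (u n) + Rabs (v n)) (fun _ => r)).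
    - intros n. destruct (Hz n) as [A _]. assert (B := Hpow n). nra.
    - apply is_lim_seq_plus'; [apply (is_lim_seq_abs u x Hx)|apply (is_lim_seq_abs v y Hy)].
    - apply is_lim_seq_const. }
  assert (Hu0 : is_lim_seq (fun n => Rabs (u n - x)) 0).
  { rewrite <- Rabs_R0, <- (Rminus_diag x).
    apply (is_lim_seq_abs _ (x - x)), is_lim_seq_minus'; [exact Hx|apply is_lim_seq_const]. }
  assert (Hv0 : is_lim_seq (fun n => Rabs (v n - y)) 0).
  { rewrite <- Rabs_R0, <- (Rminus_diag y).
    apply (is_lim_seq_abs _ (y - y)), is_lim_seq_minus'; [exact Hy|apply is_lim_seq_const]. }
  assert (Hdist : is_lim_seq (fun n => (Rabs (u n - x) + Rabs (v n - y))
    + (Rabs (u (S n) - x) + Rabs (v (S n) - y))) 0).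
  { replace 0 with ((0 + 0) + (0 + 0)) by ring.
    apply is_lim_seq_plus'; apply is_lim_seq_plus'; auto.
    - apply (is_lim_seq_incr_1 (fun n => Rabs (u n - x)) 0), Hu0.
    - apply (is_lim_seq_incr_1 (fun n => Rabs (v n - y)) 0), Hv0. }
  assert (Hfix : forall n, Rabs (f x y - x) + Rabs (g x y - y)
     <= (Rabs (u n - x) + Rabs (v n - y)) + (Rabs (u (S n) - x) + Rabs (v (S n) - y))).
  { intros n.
    assert (L : Rabs (u n) + Rabs (v n) <= r).
    { destruct (Hz n) as [A _]. assert (B := Hpow n). nra. }
    assert (A := Hlip x y (u n) (v n) Hxy L).
    assert (T1 := Rabs_triang (f x y - f (u n) (v n)) (u (S n) - x)).
    assert (T2 := Rabs_triang (g x y - g (u n) (v n)) (v (S n) - y)).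
    change (f (u n) (v n)) with (u (S n)) in *. change (g (u n) (v n)) with (v (S n)) in *.
    replace (f x y - u (S n) + (u (S n) - x)) with (f x y - x) in T1 by ring.
    replace (g x y - v (S n) + (v (S n) - y)) with (g x y - y) in T2 by ring.
    rewrite (Rabs_minus_sym x (u n)), (Rabs_minus_sym y (v n)) in A.
    assert (P1 := Rabs_pos (u n - x)). assert (P2 := Rabs_pos (v n - y)). lra. }
  exists x, y. split; [exact Hxy|].
  split; apply Rminus_diag_uniq; eapply is_lim_seq_Rabs_0_unique; try exact Hdist;
    intros n; specialize (Hfix n).
  - assert (P := Rabs_pos (g x y - y)). lra.
  - assert (P := Rabs_pos (f x y - x)). lra.
Qed.

(** * Perturbation of a single term *)

Lemma MVT_bound (f df : R -> R) (a b M : R) :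
  (forall x, Rmin a b <= x <= Rmax a b -> is_derive f x (df x)) ->
  (forall x, Rmin a b <= x <= Rmax a b -> Rabs (df x) <= M) ->
  Rabs (f b - f a) <= M * Rabs (b - a).
Proof.
  intros Hd HM. destruct (MVT_gen f a b df) as (c & Hc & E).
  - intros x Hx. apply Hd. lra.
  - intros x Hx. apply continuity_pt_filterlim.
    apply (ex_derive_continuous (K := R_AbsRing) (V := R_NormedModule)).
    exists (df x). now apply Hd.
  - rewrite E, Rabs_mult. apply Rmult_le_compat_r; [apply Rabs_pos|now apply HM].
Qed.

Lemma MVT_bound_box (f fx fy : R -> R -> R) (r M : R) :
  (forall x y, is_derive (fun x => f x y) x (fx x y)) ->
  (forall x y, is_derive (fun y => f x y) y (fy x y)) ->
  (forall x y, Rabs x <= r -> Rabs y <= r -> Rabs (fx x y) <= M) ->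
  (forall x y, Rabs x <= r -> Rabs y <= r -> Rabs (fy x y) <= M) ->
  forall x y x' y', Rabs x <= r -> Rabs y <= r -> Rabs x' <= r -> Rabs y' <= r ->
  Rabs (f x y - f x' y') <= M * (Rabs (x - x') + Rabs (y - y')).
Proof.
  intros Dx Dy Bx By x y x' y' Hx Hy Hx' Hy'.
  assert (Hbox : forall a b c, Rabs a <= r -> Rabs b <= r ->
    Rmin a b <= c <= Rmax a b -> Rabs c <= r).
  { intros a b c Ha Hb [H1 H2]. apply Rabs_le_between in Ha. apply Rabs_le_between in Hb.
    apply Rabs_le. split.
    - eapply Rle_trans; [|exact H1]. apply Rmin_glb; lra.
    - eapply Rle_trans; [exact H2|]. apply Rmax_lub; lra. }
  assert (A1 : Rabs (f x y - f x' y) <= M * Rabs (x - x')).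
  { apply (MVT_bound (fun x => f x y) (fun x => fx x y)); [auto|].
    intros c Hc. apply Bx; [now apply (Hbox x' x)|exact Hy]. }
  assert (A2 : Rabs (f x' y - f x' y') <= M * Rabs (y - y')).
  { apply (MVT_bound (fun y => f x' y) (fun y => fy x' y)); [auto|].
    intros c Hc. apply By; [exact Hx'|now apply (Hbox y' y)]. }
  replace (f x y - f x' y') with ((f x y - f x' y) + (f x' y - f x' y')) by ring.
  eapply Rle_trans; [apply Rabs_triang|lra].
Qed.

Lemma exp_le (x y : R) : x <= y -> exp x <= exp y.
Proof. intros [H| ->]; [left; now apply exp_increasing|right; reflexivity]. Qed.

Lemma exp_sub_1_bound (b r x : R) : 0 <= b -> Rabs x <= r ->
  Rabs (exp (- b * x) - 1) <= b * r * exp (b * r).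
Proof.
  intros Hb Hx. apply Rabs_le_between in Hx.
  rewrite <- exp_0, <- (Rmult_0_r (- b)).
  eapply Rle_trans.
  - apply (MVT_bound (fun x => exp (- b * x)) (fun x => - b * exp (- b * x)) 0 x
      (b * exp (b * r))).
    + intros y _. auto_derive; [trivial|ring].
    + intros y Hy. rewrite Rabs_mult, Rabs_Ropp, (Rabs_pos_eq b) by lra.
      rewrite Rabs_pos_eq by (left; apply exp_pos).
      apply Rmult_le_compat_l; [exact Hb|].
      apply exp_le. revert Hy. unfold Rmin, Rmax. destruct (Rle_dec 0 x); nra.
  - rewrite Rminus_0_r. assert (Rabs x <= r) by (apply Rabs_le; lra).
    assert (0 < exp (b * r)) by apply exp_pos.
    assert (0 <= b * exp (b * r)) by nra. nra.
Qed.

(** With [b = half_ln m] and [th = b t] the pair of cosine and sine expressions is the complex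
    conjugate of [(m + 3/2)^(-(x + iy) - it)]. It stays near -1, since [th] is nearly an odd
    multiple of [PI] and the displacement changes modulus and phase by order [b r]. *)
Lemma oscillator_bounds (b r v th x y : R) : 0 <= b ->
  Rabs (cos th + 1) <= v -> Rabs (sin th) <= v -> Rabs x <= r -> Rabs y <= r ->
  Rabs (exp (- b * x) * cos (b * y + th) + 1) <= 2 * b * r * exp (b * r) + v /\
  Rabs (exp (- b * x) * sin (b * y + th)) <= 2 * b * r * exp (b * r) + v.
Proof.
  intros Hb Hc Hs Hx Hy.
  assert (E := exp_sub_1_bound b r x Hb Hx).
  assert (Hr : 0 <= r) by (eapply Rle_trans; [apply Rabs_pos|exact Hx]).
  assert (He : 1 <= exp (b * r)) by (rewrite <- exp_0; apply exp_le; nra).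
  assert (Hbr : 0 <= b * r) by nra.
  assert (Hyr : Rabs (b * y + th - th) <= b * r).
  { replace (b * y + th - th) with (b * y) by ring.
    rewrite Rabs_mult, (Rabs_pos_eq b) by lra. nra. }
  assert (C1 : Rabs (cos (b * y + th) - cos th) <= 1 * Rabs (b * y + th - th)).
  { apply (MVT_bound cos (fun x => - sin x)).
    - intros; auto_derive; [trivial|ring].
    - intros. rewrite Rabs_Ropp. apply Rabs_le, SIN_bound. }
  assert (S1 : Rabs (sin (b * y + th) - sin th) <= 1 * Rabs (b * y + th - th)).
  { apply (MVT_bound sin cos).
    - intros; auto_derive; [trivial|ring].
    - intros. apply Rabs_le, COS_bound. }
  assert (M : forall T, Rabs T <= 1 -> Rabs ((exp (- b * x) - 1) * T) <= b * r * exp (b * r)).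
  { intros T HT. rewrite Rabs_mult. assert (P := Rabs_pos T).
    assert (Q := Rabs_pos (exp (- b * x) - 1)). nra. }
  assert (M1 := M _ (Rabs_le _ _ (COS_bound (b * y + th)))).
  assert (M2 := M _ (Rabs_le _ _ (SIN_bound (b * y + th)))).
  assert (b * r <= b * r * exp (b * r)) by nra.
  split.
  - replace (exp (- b * x) * cos (b * y + th) + 1)
      with ((exp (- b * x) - 1) * cos (b * y + th) + ((cos (b * y + th) - cos th) + (cos th + 1)))
      by ring.
    eapply Rle_trans; [apply Rabs_triang|].
    assert (T := Rabs_triang (cos (b * y + th) - cos th) (cos th + 1)). lra.
  - replace (exp (- b * x) * sin (b * y + th))
      with ((exp (- b * x) - 1) * sin (b * y + th) + ((sin (b * y + th) - sin th) + sin th))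
      by ring.
    eapply Rle_trans; [apply Rabs_triang|].
    assert (T := Rabs_triang (sin (b * y + th) - sin th) (sin th)). lra.
Qed.

(** Near the value -1 the two expressions vary almost like [b x] and [- b y]. Once these linear
    parts are removed, the partial derivatives are [b] times the deviations bounded in
    [oscillator_bounds]. *)
Lemma oscillator_lipschitz (b r v th x y x' y' : R) : 0 <= b ->
  Rabs (cos th + 1) <= v -> Rabs (sin th) <= v ->
  Rabs x <= r -> Rabs y <= r -> Rabs x' <= r -> Rabs y' <= r ->
  Rabs ((exp (- b * x) * cos (b * y + th) - b * x) - (exp (- b * x') * cos (b * y' + th) - b * x'))
   <= b * (2 * b * r * exp (b * r) + v) * (Rabs (x - x') + Rabs (y - y')) /\
  Rabs ((exp (- b * x) * sin (b * y + th) + b * y) - (exp (- b * x') * sin (b * y' + th) + b * y'))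
   <= b * (2 * b * r * exp (b * r) + v) * (Rabs (x - x') + Rabs (y - y')).
Proof.
  intros Hb Hc Hs Hx Hy Hx' Hy'.
  assert (M : forall u, Rabs u <= 2 * b * r * exp (b * r) + v ->
    Rabs (b * u) <= b * (2 * b * r * exp (b * r) + v)).
  { intros u Hu. rewrite Rabs_mult, (Rabs_pos_eq b) by lra. now apply Rmult_le_compat_l. }
  split.
  - apply (MVT_bound_box (fun x y => exp (- b * x) * cos (b * y + th) - b * x)
      (fun x y => b * - (exp (- b * x) * cos (b * y + th) + 1))
      (fun x y => b * - (exp (- b * x) * sin (b * y + th))) r); auto.
    + intros. auto_derive; [trivial|ring].
    + intros. auto_derive; [trivial|ring].
    + intros. apply M. rewrite Rabs_Ropp. now apply oscillator_bounds.
    + intros. apply M. rewrite Rabs_Ropp. now apply oscillator_bounds.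
  - apply (MVT_bound_box (fun x y => exp (- b * x) * sin (b * y + th) + b * y)
      (fun x y => b * - (exp (- b * x) * sin (b * y + th)))
      (fun x y => b * (exp (- b * x) * cos (b * y + th) + 1)) r); auto.
    + intros. auto_derive; [trivial|ring].
    + intros. auto_derive; [trivial|ring].
    + intros. apply M. rewrite Rabs_Ropp. now apply oscillator_bounds.
    + intros. apply M. now apply oscillator_bounds.
Qed.

(** * Weighted phase gaps and the Newton map *)

Lemma ex_series_le_R (a b : nat -> R) :
  (forall n, Rabs (a n) <= b n) -> ex_series b -> ex_series a.
Proof. exact (ex_series_le (K := R_AbsRing) (V := R_CompleteNormedModule) a b). Qed.

Lemma ex_series_scal_R (c : R) (a : nat -> R) :
  ex_series a -> ex_series (fun n => c * a n).
Proof. exact (ex_series_scal (K := R_AbsRing) (V := R_NormedModule) c a). Qed.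

Lemma Series_Rabs_le (a b : nat -> R) :
  (forall n, Rabs (a n) <= b n) -> ex_series b -> Rabs (Series a) <= Series b.
Proof.
  intros H Hb.
  assert (Ha : ex_series (fun n => Rabs (a n))).
  { apply (ex_series_le_R _ b); [|exact Hb]. intros n. now rewrite Rabs_Rabsolu. }
  eapply Rle_trans; [now apply Series_Rabs|].
  apply Series_le; [|exact Hb]. intros n. split; [apply Rabs_pos|apply H].
Qed.

Lemma Series_tail_small (g : nat -> R) (e : R) : ex_series g -> 0 < e ->
  exists M, (0 < M)%nat /\ Series (fun k => g (M + k)%nat) < e.
Proof.
  intros Hg He. assert (H := Series_correct g Hg).
  apply is_series_Reals in H.
  destruct (H e He) as [N HN]. exists (S N). split; [lia|].
  specialize (HN N (le_n N)).
  rewrite (Series_incr_n g (S N)) in HN; [|lia|exact Hg].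
  simpl pred in HN. unfold Rdist in HN.
  replace (sum_f_R0 g N - (sum_f_R0 g N + Series (fun k => g (S N + k)%nat)))
    with (- Series (fun k => g (S N + k)%nat)) in HN by ring.
  rewrite Rabs_Ropp in HN. apply Rabs_def2 in HN. lra.
Qed.

Definition phase_gap (t : R) (m : nat) : R :=
  Rabs (cos (half_ln m * t) + 1) + Rabs (sin (half_ln m * t)).

Lemma phase_gap_bound (t : R) (m : nat) : 0 <= phase_gap t m <= 3.
Proof.
  unfold phase_gap. assert (P1 := Rabs_pos (cos (half_ln m * t) + 1)).
  assert (P2 := Rabs_pos (sin (half_ln m * t))).
  assert (B1 := COS_bound (half_ln m * t)).
  assert (B2 : Rabs (sin (half_ln m * t)) <= 1) by apply Rabs_le, SIN_bound.
  rewrite (Rabs_pos_eq (cos (half_ln m * t) + 1)) by lra. lra.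
Qed.

Lemma ex_series_phase_gap (g : nat -> R) (t : R) :
  (forall m, 0 <= g m) -> ex_series g -> ex_series (fun m => phase_gap t m * g m).
Proof.
  intros Hg0 Hg. apply (ex_series_le_R _ (fun m => 3 * g m)).
  - intros m. assert (B := phase_gap_bound t m). specialize (Hg0 m).
    rewrite Rabs_pos_eq; nra.
  - now apply ex_series_scal_R.
Qed.

(** The tail uses the trivial bound 3 on the gap and costs at most [3 kappa / 8]. The head involves
    finitely many odd numbers [2 m + 3], all at most [2 M + 1], and is brought below [kappa / 2] by
    [odd_phases_near_pi]. *)
Lemma phase_gap_series_small (g : nat -> R) (kappa : R) :
  (forall m, 0 <= g m) -> ex_series g -> 0 < kappa ->
  exists t, Series (fun m => phase_gap t m * g m) <= kappa.
Proof.
  intros Hg0 Hg Hk.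
  destruct (Series_tail_small g (kappa / 8) Hg ltac:(lra)) as (M & HM & Htail).
  set (G := sum_f_R0 g (pred M)).
  assert (HG : 0 <= G) by (apply cond_pos_sum; exact Hg0).
  destruct (odd_phases_near_pi (2 * M + 1) (kappa / (4 * (G + 1)))) as [t Ht].
  { apply Rdiv_lt_0_compat; lra. }
  exists t. rewrite (Series_incr_n _ M HM); [|now apply ex_series_phase_gap].
  assert (A1 : sum_f_R0 (fun m => phase_gap t m * g m) (pred M)
     <= sum_f_R0 (fun m => g m * (2 * (kappa / (4 * (G + 1))))) (pred M)).
  { apply sum_Rle. intros m Hm. rewrite (Rmult_comm (g m)).
    apply Rmult_le_compat_r; [apply Hg0|].
    unfold phase_gap. rewrite half_ln_odd.
    destruct (Ht (2 * S m + 1)%nat) as [T1 T2]; [exists (S m); reflexivity|lia|]. lra. }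
  rewrite <- scal_sum in A1. fold G in A1.
  assert (A2 : 2 * (kappa / (4 * (G + 1))) * G <= kappa / 2).
  { replace (kappa / 2) with (2 * (kappa / (4 * (G + 1))) * (G + 1)) by (field; lra).
    apply Rmult_le_compat_l; [|lra].
    assert (0 < kappa / (4 * (G + 1))) by (apply Rdiv_lt_0_compat; lra). lra. }
  assert (A3 : Series (fun k => phase_gap t (M + k) * g (M + k)%nat)
     <= Series (fun k => 3 * g (M + k)%nat)).
  { apply Series_le.
    - intros k. assert (B := phase_gap_bound t (M + k)). specialize (Hg0 (M + k)%nat). nra.
    - apply ex_series_scal_R, (ex_series_incr_n g M), Hg. }
  rewrite Series_scal_l in A3. lra.
Qed.

Lemma exp_scale_le (b p q : R) : 0 <= b -> q <= p -> exp (- b * p) <= exp (- b * q).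
Proof. intros Hb H. apply exp_le. nra. Qed.

Lemma le_10_exp (b : R) : b <= 10 * exp (b / 10).
Proof. assert (H := exp_ineq1_le (b / 10)). lra. Qed.

Lemma half_point_near (sigma0 delta : R) :
  (forall x, 1 < x -> ex_series (fun m => exp (- half_ln m * x))) ->
  19 / 10 <= sigma0 -> Series (fun m => exp (- half_ln m * sigma0)) = 1 -> 0 < delta ->
  exists x t, sigma0 - delta <= x /\ 1 < x /\
    is_series (fun m => exp (- half_ln m * x) * cos (half_ln m * t)) (-1) /\
    is_series (fun m => exp (- half_ln m * x) * sin (half_ln m * t)) 0.
Proof.
  intros Hex Hs0 Hphi Hdelta.
  set (b := half_ln) in *.
  assert (Hb : forall m, 0 < b m) by exact half_ln_gt0.
  set (a := fun m => exp (- b m * sigma0)).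
  (* The exponent 8/5 is [19/10 - 3/10]: two factors [b <= 10 exp (b / 10)] and a displacement
     [exp (b r)] with [r <= 1/10] cost 1/10 each, and the weight remains summable. *)
  set (g := fun m => exp (- b m * (8 / 5))).
  assert (Ha0 : forall m, 0 < a m) by (intros; apply exp_pos).
  assert (Hg0 : forall m, 0 < g m) by (intros; apply exp_pos).
  assert (Hg0' : forall m, 0 <= g m) by (intros; left; apply Hg0).
  assert (Hg : ex_series g) by (apply Hex; lra).
  assert (Hag : forall m, a m <= g m).
  { intros m. apply exp_scale_le; [left; apply Hb|lra]. }
  assert (Habg : forall m, a m * b m <= 10 * g m).
  { intros m. apply Rle_trans with (a m * (10 * exp (b m / 10))).
    - apply Rmult_le_compat_l; [left; apply Ha0|apply le_10_exp].
    - replace (a m * (10 * exp (b m / 10))) with (10 * (a m * exp (b m / 10))) by ring.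
      apply Rmult_le_compat_l; [lra|]. unfold a. rewrite <- exp_plus.
      apply exp_le. specialize (Hb m). nra. }
  assert (Hab2g : forall m r, r <= / 10 -> a m * (b m * b m * exp (b m * r)) <= 100 * g m).
  { intros m r Hr.
    apply Rle_trans with (a m * ((10 * exp (b m / 10)) * (10 * exp (b m / 10)) * exp (b m * r))).
    - apply Rmult_le_compat_l; [left; apply Ha0|].
      apply Rmult_le_compat_r; [left; apply exp_pos|].
      assert (L := le_10_exp (b m)). specialize (Hb m).
      apply Rmult_le_compat; lra.
    - replace (a m * ((10 * exp (b m / 10)) * (10 * exp (b m / 10)) * exp (b m * r)))
        with (100 * (a m * (exp (b m / 10) * exp (b m / 10) * exp (b m * r)))) by ring.
      apply Rmult_le_compat_l; [lra|]. unfold a. rewrite <- !exp_plus.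
      apply exp_le. specialize (Hb m). nra. }
  set (G := Series g).
  assert (HG : 0 < G).
  { unfold G. rewrite Series_incr_1 by exact Hg.
    assert (0 <= Series (fun k => g (S k))).
    { rewrite <- (Rmult_0_l (Series (fun k => g (S k)))), <- Series_scal_l.
      apply Series_le; [intros n; specialize (Hg0 (S n)); lra|].
      now apply (ex_series_incr_1 g). }
    specialize (Hg0 0%nat). lra. }
  assert (Hexab : ex_series (fun m => a m * b m)).
  { apply (ex_series_le_R _ (fun m => 10 * g m)); [|now apply ex_series_scal_R].
    intros m. rewrite Rabs_pos_eq; [apply Habg|].
    apply Rmult_le_pos; left; [apply Ha0|apply Hb]. }
  set (D := Series (fun m => a m * b m)).
  assert (HD : 0 < D).
  { unfold D. rewrite Series_incr_1 by exact Hexab.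
    assert (0 <= Series (fun k => a (S k) * b (S k))).
    { rewrite <- (Rmult_0_l (Series (fun k => a (S k) * b (S k)))), <- Series_scal_l.
      apply Series_le; [|now apply (ex_series_incr_1 (fun m => a m * b m))].
      intros n. assert (0 < a (S n) * b (S n)) by (apply Rmult_lt_0_compat; auto). lra. }
    assert (0 < a 0%nat * b 0%nat) by (apply Rmult_lt_0_compat; auto). lra. }
  (* The three bounds serve [Hab2g], keep the zero within [delta], and make the second-order error
     [400 r G / D] at most 1/4. *)
  set (r := Rmin (/ 10) (Rmin delta (D / (1600 * G)))).
  assert (HDG : 0 < D / (1600 * G)) by (apply Rdiv_lt_0_compat; lra).
  assert (Hr : 0 < r) by (unfold r; repeat apply Rmin_glb_lt; lra).
  assert (Hr1 : r <= / 10) by apply Rmin_l.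
  assert (Hr2 : r <= delta) by (eapply Rle_trans; [apply Rmin_r|apply Rmin_l]).
  assert (Hr3 : r * (1600 * G) <= D).
  { replace D with (D / (1600 * G) * (1600 * G)) by (field; lra).
    apply Rmult_le_compat_r; [lra|]. eapply Rle_trans; [apply Rmin_r|apply Rmin_r]. }
  (* With this precision the phase errors add [r / 4] to the contraction constant, and the first
     Newton step has length at most [r / 40]. *)
  set (kappa := r * D / 80).
  assert (Hkap : 0 < kappa) by (unfold kappa; assert (0 < r * D) by nra; lra).
  destruct (phase_gap_series_small g kappa Hg0' Hg Hkap) as [t Ht].
  assert (Hexv := ex_series_phase_gap g t Hg0' Hg).
  assert (HexE : forall (T : R -> R) x y, (forall z, Rabs (T z) <= 1) -> Rabs x <= r ->
    ex_series (fun m => a m * (exp (- b m * x) * T (b m * y + b m * t)))).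
  { intros T x y HT Hx. apply Rabs_le_between in Hx.
    apply (ex_series_le_R _ (fun m => exp (- b m * (sigma0 + x)))); [|apply Hex; lra].
    intros m. rewrite <- Rmult_assoc. unfold a. rewrite <- exp_plus.
    replace (- b m * sigma0 + - b m * x) with (- b m * (sigma0 + x)) by ring.
    rewrite Rabs_mult, Rabs_pos_eq by (left; apply exp_pos).
    assert (P := exp_pos (- b m * (sigma0 + x))). specialize (HT (b m * y + b m * t)). nra. }
  assert (Hcos : forall z, Rabs (cos z) <= 1) by (intros; apply Rabs_le, COS_bound).
  assert (Hsin : forall z, Rabs (sin z) <= 1) by (intros; apply Rabs_le, SIN_bound).
  set (Ec := fun x y m => a m * (exp (- b m * x) * cos (b m * y + b m * t))).
  set (Es := fun x y m => a m * (exp (- b m * x) * sin (b m * y + b m * t))).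
  (* [f] and [h] are the real and imaginary part of [z - (1 + S z) / D], where [S z] sums
     [(m + 3/2)^(-sigma0 - z - it)] and [D] is the derivative at [z = 0] of the limiting function
     [1 - sum (m + 3/2)^(-sigma0 - z)]. *)
  set (f := fun x y => x - (1 + Series (Ec x y)) / D).
  set (h := fun x y => y + Series (Es x y) / D).
  set (K := 200 * r * G + 10 * kappa).
  assert (HexK : ex_series (fun m => 200 * r * g m + 10 * (phase_gap t m * g m))).
  { apply (ex_series_plus (K := R_AbsRing) (V := R_NormedModule)
      (fun m => 200 * r * g m) (fun m => 10 * (phase_gap t m * g m)));
      now apply ex_series_scal_R. }
  assert (HK : Series (fun m => 200 * r * g m + 10 * (phase_gap t m * g m)) <= K).
  { rewrite Series_plus by now apply ex_series_scal_R.
    rewrite !Series_scal_l. unfold K. fold G. lra. }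
  assert (Hterm : forall m, a m * (b m * (2 * b m * r * exp (b m * r) + phase_gap t m))
      <= 200 * r * g m + 10 * (phase_gap t m * g m)).
  { intros m. assert (A1 := Hab2g m r Hr1). assert (A2 := Habg m).
    assert (A3 := phase_gap_bound t m).
    replace (a m * (b m * (2 * b m * r * exp (b m * r) + phase_gap t m)))
      with (2 * r * (a m * (b m * b m * exp (b m * r))) + phase_gap t m * (a m * b m)) by ring.
    assert (2 * r * (a m * (b m * b m * exp (b m * r))) <= 2 * r * (100 * g m))
      by (apply Rmult_le_compat_l; lra).
    assert (phase_gap t m * (a m * b m) <= phase_gap t m * (10 * g m))
      by (apply Rmult_le_compat_l; lra). lra. }
  assert (Hgap : forall m, Rabs (cos (b m * t) + 1) <= phase_gap t m /\
     Rabs (sin (b m * t)) <= phase_gap t m).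
  { intros m. unfold phase_gap. fold b. assert (P1 := Rabs_pos (cos (b m * t) + 1)).
    assert (P2 := Rabs_pos (sin (b m * t))). lra. }
  assert (HKD : 2 * (K / D) <= / 2).
  { unfold K, kappa.
    replace (2 * ((200 * r * G + 10 * (r * D / 80)) / D))
      with ((400 * r * G + r * D / 4) / D) by (field; lra).
    apply Rle_div_l; [exact HD|]. nra. }
  destruct (contraction_fixed_point f h r) as (x & y & Hxy & Hf & Hh).
  - intros x y x' y' Hxy Hxy'.
    assert (P1 := Rabs_pos x). assert (P2 := Rabs_pos y).
    assert (P3 := Rabs_pos x'). assert (P4 := Rabs_pos y').
    assert (Hx : Rabs x <= r) by lra. assert (Hy : Rabs y <= r) by lra.
    assert (Hx' : Rabs x' <= r) by lra. assert (Hy' : Rabs y' <= r) by lra.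
    set (d := Rabs (x - x') + Rabs (y - y')).
    assert (Hd : 0 <= d) by (apply Rplus_le_le_0_compat; apply Rabs_pos).
    assert (Lip := fun m => oscillator_lipschitz (b m) r (phase_gap t m) (b m * t) x y x' y'
      (Rlt_le _ _ (Hb m)) (proj1 (Hgap m)) (proj2 (Hgap m)) Hx Hy Hx' Hy').
    assert (Bnd : forall w : nat -> R,
      (forall m, Rabs (w m) <= b m * (2 * b m * r * exp (b m * r) + phase_gap t m) * d) ->
      Rabs (Series (fun m => a m * w m)) <= K * d).
    { intros w Hw.
      apply Rle_trans with (Series (fun m => d * (200 * r * g m + 10 * (phase_gap t m * g m)))).
      - apply Series_Rabs_le; [|now apply ex_series_scal_R].
        intros m. rewrite Rabs_mult, (Rabs_pos_eq (a m)) by (left; apply Ha0).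
        apply Rle_trans with (a m * (b m * (2 * b m * r * exp (b m * r) + phase_gap t m) * d)).
        + apply Rmult_le_compat_l; [left; apply Ha0|apply Hw].
        + rewrite <- Rmult_assoc, Rmult_comm. apply Rmult_le_compat_l; [exact Hd|apply Hterm].
      - rewrite Series_scal_l. nra. }
    assert (F1 : f x y - f x' y' = - (Series (fun m => a m *
       ((exp (- b m * x) * cos (b m * y + b m * t) - b m * x)
       - (exp (- b m * x') * cos (b m * y' + b m * t) - b m * x')))) / D).
    { rewrite (Series_ext _ (fun m => (Ec x y m - Ec x' y' m) - (x - x') * (a m * b m)))
        by (intros m; unfold Ec; ring).
      rewrite Series_minus;
        [|apply (ex_series_minus (K := R_AbsRing) (V := R_NormedModule) (Ec x y) (Ec x' y'));
          now apply HexE | now apply ex_series_scal_R].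
      rewrite Series_minus by now apply HexE.
      rewrite Series_scal_l. fold D. unfold f. field. lra. }
    assert (F2 : h x y - h x' y' = Series (fun m => a m *
       ((exp (- b m * x) * sin (b m * y + b m * t) + b m * y)
       - (exp (- b m * x') * sin (b m * y' + b m * t) + b m * y'))) / D).
    { rewrite (Series_ext _ (fun m => (Es x y m - Es x' y' m) + (y - y') * (a m * b m)))
        by (intros m; unfold Es; ring).
      rewrite Series_plus;
        [|apply (ex_series_minus (K := R_AbsRing) (V := R_NormedModule) (Es x y) (Es x' y'));
          now apply HexE | now apply ex_series_scal_R].
      rewrite Series_minus by now apply HexE.
      rewrite Series_scal_l. fold D. unfold h. field. lra. }
    rewrite F1, F2. unfold Rdiv at 1 2. rewrite !Rabs_mult, Rabs_Ropp, (Rabs_pos_eq (/ D))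
      by (left; now apply Rinv_0_lt_compat).
    assert (B1 := Bnd _ (fun m => proj1 (Lip m))).
    assert (B2 := Bnd _ (fun m => proj2 (Lip m))).
    assert (0 < / D) by now apply Rinv_0_lt_compat.
    unfold Rdiv in HKD.
    apply Rle_trans with (K * d * / D + K * d * / D).
    + apply Rplus_le_compat; apply Rmult_le_compat_r; lra.
    + replace (K * d * / D + K * d * / D) with (2 * (K * / D) * d) by ring.
      now apply Rmult_le_compat_r.
  - assert (Bnd : forall w : nat -> R, (forall m, Rabs (w m) <= phase_gap t m) ->
      Rabs (Series (fun m => a m * w m)) <= kappa).
    { intros w Hw. eapply Rle_trans; [|exact Ht]. apply Series_Rabs_le; [|exact Hexv].
      intros m. rewrite Rabs_mult, (Rabs_pos_eq (a m)) by (left; apply Ha0).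
      rewrite Rmult_comm. apply Rmult_le_compat; [apply Rabs_pos|left; apply Ha0|apply Hw|apply Hag]. }
    assert (R0 : Rabs 0 <= r) by (rewrite Rabs_R0; lra).
    assert (F1 : f 0 0 = - (Series (fun m => a m * (cos (b m * t) + 1))) / D).
    { rewrite (Series_ext _ (fun m => Ec 0 0 m + a m)).
      - rewrite Series_plus; [|now apply HexE|apply Hex; lra].
        fold a in Hphi. rewrite Hphi. unfold f. field. lra.
      - intros m. unfold Ec. rewrite !Rmult_0_r, exp_0, Rplus_0_l. ring. }
    assert (F2 : h 0 0 = Series (fun m => a m * sin (b m * t)) / D).
    { rewrite (Series_ext _ (Es 0 0)).
      - unfold h. field. lra.
      - intros m. unfold Es. rewrite !Rmult_0_r, exp_0, Rplus_0_l. ring. }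
    rewrite F1, F2. unfold Rdiv at 1 2. rewrite !Rabs_mult, Rabs_Ropp, (Rabs_pos_eq (/ D))
      by (left; now apply Rinv_0_lt_compat).
    assert (B1 := Bnd _ (fun m => proj1 (Hgap m))).
    assert (B2 := Bnd _ (fun m => proj2 (Hgap m))).
    assert (0 < / D) by now apply Rinv_0_lt_compat.
    apply Rle_trans with (kappa * / D + kappa * / D).
    + apply Rplus_le_compat; apply Rmult_le_compat_r; lra.
    + unfold kappa. replace (r * D / 80 * / D + r * D / 80 * / D) with (r / 40) by (field; lra). lra.
  - assert (Hx : Rabs x <= r) by (assert (P := Rabs_pos y); lra).
    assert (Hx2 := proj1 (Rabs_le_between _ _) Hx).
    assert (Z1 : Series (Ec x y) = -1).
    { unfold f in Hf. assert (E : (1 + Series (Ec x y)) / D * D = 0)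
        by (replace ((1 + Series (Ec x y)) / D) with 0 by lra; ring).
      replace ((1 + Series (Ec x y)) / D * D) with (1 + Series (Ec x y)) in E by (field; lra). lra. }
    assert (Z2 : Series (Es x y) = 0).
    { unfold h in Hh. assert (E : Series (Es x y) / D * D = 0)
        by (replace (Series (Es x y) / D) with 0 by lra; ring).
      replace (Series (Es x y) / D * D) with (Series (Es x y)) in E by (field; lra). lra. }
    exists (sigma0 + x), (t + y). repeat split; [lra..| |].
    + apply (is_series_ext (Ec x y)).
      * intros m. unfold Ec, a. rewrite <- Rmult_assoc, <- exp_plus. f_equal; f_equal; ring.
      * rewrite <- Z1. apply Series_correct. now apply HexE.
    + apply (is_series_ext (Es x y)).
      * intros m. unfold Es, a. rewrite <- Rmult_assoc, <- exp_plus. f_equal; f_equal; ring.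
      * rewrite <- Z2. apply Series_correct. now apply HexE.
Qed.

(** * The midpoint Euler-Maclaurin formula *)

Ltac eq_in_R := match goal with |- @eq _ ?a ?b => change (@eq R a b) end.

Fixpoint rsum (f : nat -> R) (n : nat) : R :=
  match n with O => 0 | S n => rsum f n + f n end.

Lemma rsum_S (f : nat -> R) (n : nat) : rsum f (S n) = rsum f n + f n.
Proof. reflexivity. Qed.

Lemma rsum_ext (f g : nat -> R) (n : nat) :
  (forall k, (k < n)%nat -> f k = g k) -> rsum f n = rsum g n.
Proof.
  induction n as [|n IH]; intros H; simpl; [reflexivity|].
  rewrite IH by (intros; apply H; lia). now rewrite H by lia.
Qed.

Lemma rsum_le (f g : nat -> R) (n : nat) :
  (forall k, (k < n)%nat -> f k <= g k) -> rsum f n <= rsum g n.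
Proof.
  induction n as [|n IH]; intros H; simpl; [lra|].
  apply Rplus_le_compat; [apply IH; intros; apply H; lia|apply H; lia].
Qed.

Lemma rsum_plus (f g : nat -> R) (n : nat) :
  rsum (fun k => f k + g k) n = rsum f n + rsum g n.
Proof. induction n as [|n IH]; simpl; [ring|rewrite IH; ring]. Qed.

Lemma rsum_scal (c : R) (f : nat -> R) (n : nat) :
  rsum (fun k => c * f k) n = c * rsum f n.
Proof. induction n as [|n IH]; simpl; [ring|rewrite IH; ring]. Qed.

Lemma rsum_Rabs (f : nat -> R) (n : nat) :
  Rabs (rsum f n) <= rsum (fun k => Rabs (f k)) n.
Proof.
  induction n as [|n IH]; simpl; [rewrite Rabs_R0; lra|].
  eapply Rle_trans; [apply Rabs_triang|lra].
Qed.

Lemma rsum_split_first (f : nat -> R) (n : nat) :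
  rsum f (S n) = f 0%nat + rsum (fun k => f (S k)) n.
Proof.
  induction n as [|n IH]; [simpl; ring|].
  change (rsum f (S n) + f (S n) = f 0%nat + (rsum (fun k => f (S k)) n + f (S n))).
  rewrite IH. ring.
Qed.

Lemma rsum_triangle (G : nat -> nat -> R) (n : nat) :
  rsum (fun k => rsum (G k) (n - k)) n = rsum (fun i => rsum (fun k => G k (i - k)%nat) (S i)) n.
Proof.
  induction n as [|n IH]; [reflexivity|].
  change (rsum (fun k => rsum (G k) (S n - k)) n + rsum (G n) (S n - n) =
    rsum (fun i => rsum (fun k => G k (i - k)%nat) (S i)) n + rsum (fun k => G k (n - k)%nat) (S n)).
  rewrite <- IH.
  rewrite (rsum_ext _ (fun k => rsum (G k) (n - k) + G k (n - k)%nat)).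
  - rewrite rsum_plus. replace (S n - n)%nat with 1%nat by lia. simpl.
    replace (n - n)%nat with 0%nat by lia. ring.
  - intros k Hk. replace (S n - k)%nat with (S (n - k)) by lia. reflexivity.
Qed.

Lemma rsum_odd (f : nat -> R) (n : nat) :
  (forall i, f (2 * i)%nat = 0) -> rsum f (2 * n + 1) = rsum (fun i => f (2 * i + 1)%nat) n.
Proof.
  intros H. induction n as [|n IH].
  - simpl. specialize (H 0%nat). simpl in H. lra.
  - replace (2 * S n + 1)%nat with (S (S (2 * n + 1))) by lia.
    change (rsum f (2 * n + 1) + f (2 * n + 1)%nat + f (S (2 * n + 1)) =
      rsum (fun i => f (2 * i + 1)%nat) n + f (2 * n + 1)%nat).
    rewrite IH. replace (S (2 * n + 1)) with (2 * (S n))%nat by lia. rewrite H. ring.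
Qed.

Lemma is_derive_rsum (f df : nat -> R -> R) (n : nat) (x : R) :
  (forall k, (k < n)%nat -> is_derive (f k) x (df k x)) ->
  is_derive (fun x => rsum (fun k => f k x) n) x (rsum (fun k => df k x) n).
Proof.
  induction n as [|n IH]; intros H; simpl.
  - apply (is_derive_const (K := R_AbsRing) (V := R_NormedModule)).
  - apply (is_derive_plus (fun x => rsum (fun k => f k x) n) (f n)).
    + apply IH. intros k Hk. apply H. lia.
    + apply H. lia.
Qed.

Lemma derive_ge0_le (f df : R -> R) (H : R) :
  (forall x, 0 <= x <= H -> is_derive f x (df x)) ->
  (forall x, 0 <= x <= H -> 0 <= df x) ->
  forall x, 0 <= x <= H -> f 0 <= f x.
Proof.
  intros Hd Hp x Hx. destruct (MVT_gen f 0 x df) as (c & Hc & E).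
  - rewrite Rmin_left, Rmax_right by lra. intros y Hy. apply Hd. lra.
  - rewrite Rmin_left, Rmax_right by lra. intros y Hy. apply continuity_pt_filterlim.
    apply (ex_derive_continuous (K := R_AbsRing) (V := R_NormedModule)).
    exists (df y). apply Hd. lra.
  - rewrite Rmin_left, Rmax_right in Hc by lra.
    assert (0 <= df c * (x - 0)) by (apply Rmult_le_pos; [apply Hp|]; lra). lra.
Qed.

Lemma is_derive_pow_fact (c h : R) (n : nat) :
  is_derive (fun h => c * (h ^ S n / INR (fact (S n)))) h (c * (h ^ n / INR (fact n))).
Proof.
  assert (HS : INR (S n) <> 0) by (apply not_0_INR; lia).
  assert (HF := INR_fact_neq_0 n).
  rewrite fact_simpl, mult_INR. auto_derive; [trivial|].
  simpl pred. field. auto.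
Qed.

(** Here [psi j] stands for the [j]-th derivative. The bound for the shifted family [psi (S j)] is
    integrated by monotonicity of [w + u] and [w - u], where [w] is a primitive of that bound and
    [u] the remainder. *)
Lemma taylor_bound (psi : nat -> R -> R) (H M : R) (n : nat) :
  (forall j h, (j < n)%nat -> 0 <= h <= H -> is_derive (psi j) h (psi (S j) h)) ->
  (forall h, 0 <= h <= H -> Rabs (psi n h) <= M) ->
  forall h, 0 <= h <= H ->
  Rabs (psi 0%nat h - rsum (fun j => psi j 0 * (h ^ j / INR (fact j))) n)
    <= M * (h ^ n / INR (fact n)).
Proof.
  revert psi. induction n as [|n IH]; intros psi Hd HM h Hh.
  - simpl. rewrite Rminus_0_r. specialize (HM h Hh). lra.
  - assert (IH' := IH (fun j => psi (S j)) (fun j h Hj => Hd (S j) h ltac:(lia)) HM).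
    cbv beta in IH'.
    set (u := fun h => psi 0%nat h - rsum (fun j => psi j 0 * (h ^ j / INR (fact j))) (S n)).
    set (du := fun h => psi 1%nat h - rsum (fun j => psi (S j) 0 * (h ^ j / INR (fact j))) n).
    assert (Hu0 : u 0 = 0).
    { unfold u. rewrite rsum_split_first, (rsum_ext _ (fun _ => 0 * 0)).
      - rewrite rsum_scal. simpl. field.
      - intros k _. rewrite pow_ne_zero by lia. unfold Rdiv. ring. }
    assert (Hu : forall h, 0 <= h <= H -> is_derive u h (du h)).
    { intros x Hx. apply (is_derive_ext (fun h => (psi 0%nat h - psi 0%nat 0)
        - rsum (fun j => psi (S j) 0 * (h ^ S j / INR (fact (S j)))) n)).
      { intros y. unfold u. rewrite rsum_split_first.
        replace (y ^ 0 / INR (fact 0)) with 1 by (simpl; field). rewrite Rmult_1_r.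
        eq_in_R. ring. }
      apply (is_derive_minus (fun h => psi 0%nat h - psi 0%nat 0)).
      - replace (psi 1%nat x) with (psi 1%nat x - 0) by ring.
        apply (is_derive_minus (psi 0%nat) (fun _ => psi 0%nat 0)).
        + apply Hd; [lia|exact Hx].
        + apply (is_derive_const (K := R_AbsRing) (V := R_NormedModule)).
      - apply (is_derive_rsum (fun j h => psi (S j) 0 * (h ^ S j / INR (fact (S j))))
          (fun j h => psi (S j) 0 * (h ^ j / INR (fact j)))).
        intros k _. apply is_derive_pow_fact. }
    set (w := fun h => M * (h ^ S n / INR (fact (S n)))).
    set (dw := fun h => M * (h ^ n / INR (fact n))).
    assert (Hw : forall h, is_derive w h (dw h)) by (intros; apply is_derive_pow_fact).
    assert (Hw0 : w 0 = 0) by (unfold w; rewrite pow_ne_zero by lia; unfold Rdiv; ring).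
    assert (Hb : forall h, 0 <= h <= H -> - dw h <= du h <= dw h).
    { intros x Hx. apply Rabs_le_between. now apply IH'. }
    change (Rabs (u h) <= w h). apply Rabs_le. split.
    + assert (A : w 0 + u 0 <= w h + u h); [|lra].
      apply (derive_ge0_le (fun h => w h + u h) (fun h => dw h + du h) H); [| |exact Hh].
      * intros x Hx. apply (is_derive_plus w u); auto.
      * intros x Hx. specialize (Hb x Hx). lra.
    + assert (A : w 0 - u 0 <= w h - u h); [|lra].
      apply (derive_ge0_le (fun h => w h - u h) (fun h => dw h - du h) H); [| |exact Hh].
      * intros x Hx. apply (is_derive_minus w u); auto.
      * intros x Hx. specialize (Hb x Hx). lra.
Qed.

(** [negpow a x] is [x ^ (-a)] for [x > 0]. *)
Definition negpow (a x : R) : R := exp (- a * ln x).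

Lemma negpow_gt0 (a x : R) : 0 < negpow a x.
Proof. apply exp_pos. Qed.

Lemma negpow_le (a x y : R) : 0 <= a -> 0 < x <= y -> negpow a y <= negpow a x.
Proof.
  intros Ha Hx. apply exp_le. assert (ln x <= ln y) by (apply ln_le; lra). nra.
Qed.

Lemma is_derive_negpow (a x : R) : 0 < x -> is_derive (negpow a) x (- a * negpow (a + 1) x).
Proof.
  intros Hx. unfold negpow. auto_derive; [exact Hx|].
  replace (- (a + 1) * ln x) with (- a * ln x + - ln x) by ring.
  rewrite exp_plus, exp_Ropp, exp_ln by exact Hx. field. lra.
Qed.

Fixpoint poch (a : R) (n : nat) : R :=
  match n with O => 1 | S n => poch a n * (a + INR n) end.

Lemma poch_add (a : R) (m n : nat) : poch a (m + n) = poch a m * poch (a + INR m) n.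
Proof.
  induction n as [|n IH].
  - rewrite Nat.add_0_r. simpl. ring.
  - rewrite Nat.add_succ_r. simpl. rewrite IH, plus_INR. ring.
Qed.

Lemma poch_gt0 (a : R) (n : nat) : 0 < a -> 0 < poch a n.
Proof.
  intros Ha. induction n as [|n IH]; simpl; [lra|].
  apply Rmult_lt_0_compat; [exact IH|]. assert (H := pos_INR n). lra.
Qed.

(** Coefficients of [sinh (t / 2) / (t / 2)] in powers of [t^2]; a symmetric difference with
    half-step 1/2 is [2 sinh (d / 2)] in the derivation [d], up to sign. *)
Definition sym_coef (i : nat) : R := / (4 ^ i * INR (fact (2 * i + 1))).

Lemma half_pow_fact (i : nat) :
  2 * ((/ 2) ^ (2 * i + 1) / INR (fact (2 * i + 1))) = sym_coef i.
Proof.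
  unfold sym_coef. rewrite pow_add, pow_mult, pow_1.
  replace ((/ 2) ^ 2) with (/ 4) by field. rewrite pow_inv.
  field. split; [apply INR_fact_neq_0|apply pow_nonzero; lra].
Qed.

(** Taylor expansion in the half-step [h], taken at [h = 1/2]; at [h = 0] the derivatives of even
    order cancel. In the remainder both negative powers are at most their value at [y - 1/2]. *)
Lemma negpow_sym_diff (a y : R) (q : nat) : 0 < a -> / 2 < y ->
  Rabs (negpow a (y - / 2) - negpow a (y + / 2)
        - rsum (fun i => sym_coef i * (poch a (2 * i + 1) * negpow (a + INR (2 * i + 1)) y)) q)
  <= sym_coef q * (poch a (2 * q + 1) * negpow (a + INR (2 * q + 1)) (y - / 2)).
Proof.
  intros Ha Hy.
  set (psi := fun j h => poch a j * (negpow (a + INR j) (y - h) - (-1) ^ j * negpow (a + INR j) (y + h))).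
  assert (T := taylor_bound psi (/ 2)
    (2 * (poch a (2 * q + 1) * negpow (a + INR (2 * q + 1)) (y - / 2))) (2 * q + 1)).
  assert (Hpos : forall n, 0 < a + INR n) by (intros n; assert (H := pos_INR n); lra).
  rewrite <- half_pow_fact.
  replace (negpow a (y - / 2) - negpow a (y + / 2)) with (psi 0%nat (/ 2))
    by (unfold psi; simpl; rewrite Rplus_0_r; ring).
  rewrite (rsum_ext _ (fun i => psi (2 * i + 1)%nat 0 * ((/ 2) ^ (2 * i + 1) / INR (fact (2 * i + 1))))).
  - rewrite <- (rsum_odd (fun j => psi j 0 * ((/ 2) ^ j / INR (fact j)))).
    + eapply Rle_trans; [apply T|right; ring].
      * intros j h _ Hh. unfold psi.
        apply (is_derive_ext (fun h => poch a j * (negpow (a + INR j) (y - h))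
          + (- poch a j * (-1) ^ j) * negpow (a + INR j) (y + h))); [intros; eq_in_R; ring|].
        replace (poch a (S j) * (negpow (a + INR (S j)) (y - h) - (-1) ^ S j * negpow (a + INR (S j)) (y + h)))
          with (poch a j * (-1 * (- (a + INR j) * negpow (a + INR j + 1) (y - h)))
            + (- poch a j * (-1) ^ j) * (1 * (- (a + INR j) * negpow (a + INR j + 1) (y + h)))).
        2: { rewrite S_INR. simpl poch. simpl pow.
             replace (a + (INR j + 1)) with (a + INR j + 1) by ring. ring. }
        apply (is_derive_plus (fun h => poch a j * negpow (a + INR j) (y - h))
          (fun h => (- poch a j * (-1) ^ j) * negpow (a + INR j) (y + h)));
          apply is_derive_scal; apply (is_derive_comp (negpow (a + INR j))).
        -- apply is_derive_negpow. lra.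
        -- auto_derive; [trivial|ring].
        -- apply is_derive_negpow. lra.
        -- auto_derive; [trivial|ring].
      * intros h Hh. unfold psi.
        rewrite Rabs_mult, Rabs_pos_eq by (left; apply poch_gt0, Ha).
        rewrite (Rmult_comm 2), Rmult_assoc.
        apply Rmult_le_compat_l; [left; apply poch_gt0, Ha|].
        rewrite pow_add, pow_mult, pow_1. replace ((-1) ^ 2) with 1 by ring. rewrite pow1.
        assert (P1 := negpow_gt0 (a + INR (2 * q + 1)) (y - h)).
        assert (P2 := negpow_gt0 (a + INR (2 * q + 1)) (y + h)).
        assert (L1 : negpow (a + INR (2 * q + 1)) (y - h) <= negpow (a + INR (2 * q + 1)) (y - / 2))
          by (apply negpow_le; [left; apply Hpos|lra]).
        assert (L2 : negpow (a + INR (2 * q + 1)) (y + h) <= negpow (a + INR (2 * q + 1)) (y - / 2))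
          by (apply negpow_le; [left; apply Hpos|lra]).
        rewrite Rabs_pos_eq; lra.
      * lra.
    + intros i. unfold psi. rewrite Rminus_0_r, Rplus_0_r, pow_mult.
      replace ((-1) ^ 2) with 1 by ring. rewrite pow1. ring.
  - intros i _. rewrite <- half_pow_fact. unfold psi.
    rewrite Rminus_0_r, Rplus_0_r, (pow_add (-1)), pow_mult, pow_1.
    replace ((-1) ^ 2) with 1 by ring. rewrite pow1. ring.
Qed.

(** The factor of [beta k] is the [2k]-th derivative of [x^(-p)], and [x^(-p)] is the integral of
    [p y^(-p-1)] from [x] to infinity: leading term and corrections of the midpoint formula for the
    tail sum. *)
Definition em_main (beta : nat -> R) (p : R) (n : nat) (x : R) : R :=
  rsum (fun k => beta k * (poch p (2 * k) * negpow (p + INR (2 * k)) x)) n.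

(** Truncating the expansion of the [k]-th correction after [n - k] terms brings all remainders to
    the common order [2n + 1]; their coefficients add up to this sum. *)
Definition em_defect (beta : nat -> R) (n : nat) : R :=
  rsum (fun k => Rabs (beta k) * sym_coef (n - k)) n.

Lemma sym_coef_gt0 (i : nat) : 0 < sym_coef i.
Proof.
  apply Rinv_0_lt_compat, Rmult_lt_0_compat; [apply pow_lt; lra|apply INR_fact_lt_0].
Qed.

Lemma em_defect_ge0 (beta : nat -> R) (n : nat) : 0 <= em_defect beta n.
Proof.
  unfold em_defect. rewrite <- (Rmult_0_l (rsum (fun _ => 0) n)), <- rsum_scal.
  apply rsum_le. intros k _. rewrite Rmult_0_l.
  apply Rmult_le_pos; [apply Rabs_pos|left; apply sym_coef_gt0].
Qed.

(* The condition on [beta] says that the power series of [beta] and [sym_coef] are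
   inverse to each other up to order [n], so the Taylor expansion of the symmetric
   difference of [em_main] collapses to its first term. *)
Lemma em_step (beta : nat -> R) (p y : R) (n : nat) : 0 < p -> / 2 < y -> (0 < n)%nat ->
  beta 0%nat = 1 ->
  (forall i, (0 < i < n)%nat -> rsum (fun k => beta k * sym_coef (i - k)) (S i) = 0) ->
  Rabs (em_main beta p n (y - / 2) - em_main beta p n (y + / 2) - p * negpow (p + 1) y)
  <= em_defect beta n * (poch p (2 * n + 1) * negpow (p + INR (2 * n + 1)) (y - / 2)).
Proof.
  intros Hp Hy Hn Hb0 Hb.
  assert (Hpos : forall k, 0 < p + INR k) by (intros k; assert (H := pos_INR k); lra).
  set (P := fun i => poch p (2 * i + 1) * negpow (p + INR (2 * i + 1)) y).
  set (main := fun k => rsum (fun i => sym_coef i * (poch (p + INR (2 * k)) (2 * i + 1)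
     * negpow (p + INR (2 * k) + INR (2 * i + 1)) y)) (n - k)).
  assert (Hmain : rsum (fun k => beta k * (poch p (2 * k) * main k)) n = p * negpow (p + 1) y).
  { rewrite (rsum_ext _ (fun k => rsum (fun i => beta k * sym_coef i * P (k + i)%nat) (n - k))).
    2: { intros k _. unfold main. rewrite <- !rsum_scal. apply rsum_ext. intros i _.
         unfold P. replace (2 * (k + i) + 1)%nat with (2 * k + (2 * i + 1))%nat by lia.
         rewrite (poch_add p (2 * k)), (plus_INR (2 * k)), <- Rplus_assoc. ring. }
    (* Grouped by [i + k], every group except the first vanishes by the hypothesis on [beta]. *)
    rewrite (rsum_triangle (fun k i => beta k * sym_coef i * P (k + i)%nat)).
    rewrite (rsum_ext _ (fun i => rsum (fun k => beta k * sym_coef (i - k)) (S i) * P i)).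
    2: { intros i _. rewrite Rmult_comm, <- rsum_scal. apply rsum_ext. intros k Hk.
         replace (k + (i - k))%nat with i by lia. ring. }
    destruct n as [|n]; [lia|]. rewrite rsum_split_first.
    match goal with |- ?a + ?b = _ => replace b with 0 end.
    2: { symmetry. rewrite (rsum_ext _ (fun _ => 0 * 0)), rsum_scal; [ring|].
         intros i Hi. rewrite Hb by lia. ring. }
    unfold P, sym_coef. simpl. rewrite Hb0. field. }
  rewrite <- Hmain. unfold em_main.
  match goal with |- Rabs (?a - ?b - ?c) <= _ =>
    replace (a - b - c) with (rsum (fun k => beta k * (poch p (2 * k) *
      (negpow (p + INR (2 * k)) (y - / 2) - negpow (p + INR (2 * k)) (y + / 2) - main k))) n) end.
  2: { match goal with |- _ = ?a - ?b - ?c => replace (a - b - c) with (a + (-1) * b + (-1) * c) by ring end.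
       rewrite <- !rsum_scal, <- !rsum_plus. apply rsum_ext. intros. ring. }
  eapply Rle_trans; [apply rsum_Rabs|].
  unfold em_defect. rewrite Rmult_comm, <- rsum_scal. apply rsum_le. intros k Hk.
  assert (D := negpow_sym_diff (p + INR (2 * k)) y (n - k) (Hpos _) Hy). fold (main k) in D.
  rewrite !Rabs_mult, (Rabs_pos_eq (poch p (2 * k))) by (left; now apply poch_gt0).
  eapply Rle_trans.
  - apply Rmult_le_compat_l; [apply Rabs_pos|].
    apply Rmult_le_compat_l; [left; now apply poch_gt0|exact D].
  - right. replace (2 * n + 1)%nat with (2 * k + (2 * (n - k) + 1))%nat by lia.
    rewrite (poch_add p (2 * k)), (plus_INR (2 * k)), <- Rplus_assoc. ring.
Qed.

Lemma negpow_INR (k : nat) (x : R) : 0 < x -> negpow (INR k) x = / x ^ k.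
Proof.
  intros Hx. unfold negpow.
  replace (- INR k * ln x) with (- (ln (x ^ k))) by (rewrite ln_pow by exact Hx; ring).
  rewrite exp_Ropp, exp_ln; [reflexivity|now apply pow_lt].
Qed.

(** Two powers are spent on [1 / x^2 <= 1 / (x - 1) - 1 / x], which telescopes along
    [x = N, N + 1, ...]; the other integer powers are bounded at [N], and [x^(-p)] by 1. *)
Lemma negpow_tail_le (p x : R) (n N : nat) : 0 < p -> (1 < N)%nat -> INR N <= x ->
  negpow (p + INR (2 * S n + 1)) x <= / INR N ^ (2 * n + 1) * (/ (x - 1) - / x).
Proof.
  intros Hp HN Hx.
  assert (H2 : 2 <= INR N) by (apply (le_INR 2); lia).
  assert (Hlx : 0 <= ln x) by (rewrite <- ln_1; apply ln_le; lra).
  apply Rle_trans with (negpow (INR (2 * S n + 1)) x).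
  { apply exp_le. nra. }
  rewrite negpow_INR by lra.
  replace (2 * S n + 1)%nat with ((2 * n + 1) + 2)%nat by lia.
  rewrite pow_add, Rinv_mult.
  assert (0 < INR N ^ (2 * n + 1)) by (apply pow_lt; lra).
  apply Rmult_le_compat.
  - left. apply Rinv_0_lt_compat, pow_lt. lra.
  - left. apply Rinv_0_lt_compat, pow_lt. lra.
  - apply Rinv_le_contravar; [assumption|]. apply pow_incr. lra.
  - replace (/ (x - 1) - / x) with (/ (x * (x - 1))) by (field; lra).
    apply Rinv_le_contravar; nra.
Qed.

Lemma em_sum (beta : nat -> R) (p : R) (n N M : nat) : 0 < p -> (1 < N)%nat ->
  beta 0%nat = 1 ->
  (forall i, (0 < i < S n)%nat -> rsum (fun k => beta k * sym_coef (i - k)) (S i) = 0) ->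
  Rabs (em_main beta p (S n) (INR N) - em_main beta p (S n) (INR (N + M))
        - p * rsum (fun j => negpow (p + 1) (INR (N + j) + / 2)) M)
  <= em_defect beta (S n) * poch p (2 * S n + 1) * / INR N ^ (2 * n + 1)
     * (/ (INR N - 1) - / (INR (N + M) - 1)).
Proof.
  intros Hp HN Hb0 Hb.
  assert (H2 : 2 <= INR N) by (apply (le_INR 2); lia).
  induction M as [|M IH].
  - rewrite Nat.add_0_r. simpl rsum. rewrite Rmult_0_r, !Rminus_diag, Rabs_R0. lra.
  - assert (HM : INR N <= INR (N + M)) by (apply le_INR; lia).
    set (y := INR (N + M) + / 2).
    assert (St := em_step beta p y (S n) Hp ltac:(unfold y; lra) ltac:(lia) Hb0 Hb).
    replace (y - / 2) with (INR (N + M)) in St by (unfold y; ring).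
    replace (y + / 2) with (INR (N + S M)) in St
      by (unfold y; rewrite Nat.add_succ_r, S_INR; lra).
    simpl rsum. fold y. rewrite Rmult_plus_distr_l.
    match goal with |- Rabs (?a - ?b - (?c + ?d)) <= _ =>
      replace (a - b - (c + d)) with
        ((a - em_main beta p (S n) (INR (N + M)) - c) + (em_main beta p (S n) (INR (N + M)) - b - d)) by ring end.
    eapply Rle_trans; [apply Rabs_triang|].
    eapply Rle_trans; [apply Rplus_le_compat; [exact IH|exact St]|].
    assert (T := negpow_tail_le p (INR (N + M)) n N Hp HN HM).
    set (Q := em_defect beta (S n) * poch p (2 * S n + 1)).
    assert (HQ : 0 <= Q).
    { apply Rmult_le_pos; [apply em_defect_ge0|left; now apply poch_gt0]. }
    rewrite <- Rmult_assoc. fold Q.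
    assert (T' := Rmult_le_compat_l Q _ _ HQ T).
    replace (INR (N + S M) - 1) with (INR (N + M)) by (rewrite Nat.add_succ_r, S_INR; ring).
    eapply Rle_trans; [apply Rplus_le_compat_l; exact T'|right; ring].
Qed.

Lemma is_lim_seq_negpow (a : R) (N : nat) : 0 < a ->
  is_lim_seq (fun M => negpow a (INR (N + M))) 0.
Proof.
  intros Ha. unfold negpow.
  apply (is_lim_seq_ext (fun M => exp (- a * ln (INR (M + N))))).
  { intros M. now rewrite Nat.add_comm. }
  apply (is_lim_seq_incr_n (fun M => exp (- a * ln (INR M)))).
  eapply (is_lim_comp_seq exp _ m_infty 0).
  - apply is_lim_exp_m.
  - exists 0%nat. intros. discriminate.
  - replace m_infty with (Rbar_mult (- a) p_infty).
    + apply is_lim_seq_scal_l. eapply (is_lim_comp_seq ln _ p_infty p_infty).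
      * apply is_lim_ln_p.
      * exists 0%nat. intros. discriminate.
      * apply is_lim_seq_INR.
    + apply is_Rbar_mult_unique, is_Rbar_mult_sym, is_Rbar_mult_p_infty_neg. simpl. lra.
Qed.

Lemma is_lim_seq_em_main (beta : nat -> R) (p : R) (n N : nat) : 0 < p ->
  is_lim_seq (fun M => em_main beta p n (INR (N + M))) 0.
Proof.
  intros Hp. unfold em_main. induction n as [|n IH]; simpl rsum.
  - apply is_lim_seq_const.
  - replace 0 with (0 + beta n * (poch p (2 * n) * 0)) by ring.
    apply is_lim_seq_plus'; [exact IH|].
    apply (is_lim_seq_scal_l _ (beta n) (poch p (2 * n) * 0)).
    apply (is_lim_seq_scal_l _ (poch p (2 * n)) 0).
    apply is_lim_seq_negpow. apply Rplus_lt_le_0_compat; [exact Hp|apply pos_INR].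
Qed.

Lemma sum_n_rsum (f : nat -> R) (n : nat) : sum_n f n = rsum f (S n).
Proof.
  induction n as [|n IH]; [rewrite sum_O; simpl; ring|].
  rewrite sum_Sn, IH. reflexivity.
Qed.

Lemma em_series (beta : nat -> R) (p v : R) (n N : nat) : 0 < p -> (1 < N)%nat ->
  beta 0%nat = 1 ->
  (forall i, (0 < i < S n)%nat -> rsum (fun k => beta k * sym_coef (i - k)) (S i) = 0) ->
  is_series (fun j => negpow (p + 1) (INR (N + j) + / 2)) v ->
  Rabs (p * v - em_main beta p (S n) (INR N))
  <= em_defect beta (S n) * poch p (2 * S n + 1) * / INR N ^ (2 * n + 1) * / (INR N - 1).
Proof.
  intros Hp HN Hb0 Hb Hv.
  assert (H2 : 2 <= INR N) by (apply (le_INR 2); lia).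
  set (E := em_main beta p (S n)). set (Q := em_defect beta (S n) * poch p (2 * S n + 1) * / INR N ^ (2 * n + 1)).
  assert (HQ : 0 <= Q).
  { unfold Q. apply Rmult_le_pos; [|left; apply Rinv_0_lt_compat, pow_lt; lra].
    apply Rmult_le_pos; [apply em_defect_ge0|left; now apply poch_gt0]. }
  assert (L : is_lim_seq (fun M => Rabs (E (INR N) - E (INR (N + S M))
     - p * rsum (fun j => negpow (p + 1) (INR (N + j) + / 2)) (S M)))
     (Rabs (E (INR N) - 0 - p * v))).
  { apply (is_lim_seq_abs _ (E (INR N) - 0 - p * v)). apply is_lim_seq_minus'.
    - apply is_lim_seq_minus'; [apply is_lim_seq_const|].
      apply (is_lim_seq_incr_1 (fun M => E (INR (N + M))) 0).
      now apply is_lim_seq_em_main.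
    - apply (is_lim_seq_scal_l _ p v).
      apply (is_lim_seq_ext (sum_n (fun j => negpow (p + 1) (INR (N + j) + / 2)))).
      + intros M. apply sum_n_rsum.
      + exact Hv. }
  assert (B : Rbar_le (Rabs (E (INR N) - 0 - p * v)) (Q * / (INR N - 1))).
  { eapply is_lim_seq_le; [|exact L|apply is_lim_seq_const].
    intros M. eapply Rle_trans; [apply em_sum; auto|]. fold Q.
    apply Rmult_le_compat_l; [exact HQ|].
    assert (INR N <= INR (N + S M)) by (apply le_INR; lia).
    assert (0 < / (INR (N + S M) - 1)) by (apply Rinv_0_lt_compat; lra). lra. }
  simpl in B. rewrite Rabs_minus_sym. rewrite Rminus_0_r in B. exact B.
Qed.

(** * Interval arithmetic *)

Definition ival : Type := (Z * Z)%type.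

(** The 45 decimals take about 150 bits; the remaining ones absorb rounding. *)
Definition prec : Z := 176.

Definition scale : Z := (2 ^ prec)%Z.

Definition inI (i : ival) (x : R) : Prop :=
  IZR (fst i) <= x * IZR scale <= IZR (snd i).

Lemma scale_gt0 : 0 < IZR scale.
Proof. now apply IZR_lt. Qed.

Definition addI (i j : ival) : ival := ((fst i + fst j)%Z, (snd i + snd j)%Z).
Definition oppI (i : ival) : ival := ((- snd i)%Z, (- fst i)%Z).
(** The trivial lower end 0 suffices, since an error bound is read from the upper end. *)
Definition absI (i : ival) : ival := (0%Z, Z.max (- fst i) (snd i)).
Definition mulzI (i : ival) (n : Z) : ival := ((fst i * n)%Z, (snd i * n)%Z).
Definition divI (i : ival) (n : Z) : ival := ((fst i / n)%Z, (snd i / n + 1)%Z).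
Definition ratI (a b : Z) : ival := ((a * scale / b)%Z, (a * scale / b + 1)%Z).
Definition intI (a : Z) : ival := ((a * scale)%Z, (a * scale)%Z).

(** Sound only for a nonnegative left factor. *)
Definition mulI (i j : ival) : ival :=
  (Z.shiftr ((if (0 <=? fst j)%Z then fst i else snd i) * fst j) prec,
   (Z.shiftr ((if (0 <=? snd j)%Z then snd i else fst i) * snd j) prec + 1)%Z).

Lemma IZR_div_bounds (a n : Z) : (0 < n)%Z ->
  IZR (a / n) <= IZR a / IZR n <= IZR (a / n + 1).
Proof.
  intros Hn. assert (Hn' : 0 < IZR n) by now apply IZR_lt.
  assert (H1 := Z.mul_div_le a n Hn). assert (H2 := Z.mul_succ_div_gt a n Hn).
  apply IZR_le in H1. apply IZR_lt in H2. rewrite mult_IZR in H1, H2.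
  rewrite succ_IZR in H2. rewrite plus_IZR. split.
  - apply Rle_div_r; lra.
  - apply Rle_div_l; lra.
Qed.

Lemma addI_correct (i j : ival) (x y : R) : inI i x -> inI j y -> inI (addI i j) (x + y).
Proof. unfold inI; simpl. intros Hx Hy. rewrite !plus_IZR. lra. Qed.

Lemma oppI_correct (i : ival) (x : R) : inI i x -> inI (oppI i) (- x).
Proof. unfold inI; simpl. intros Hx. rewrite !opp_IZR. lra. Qed.

Lemma absI_correct (i : ival) (x : R) : inI i x -> inI (absI i) (Rabs x).
Proof.
  unfold inI; simpl. intros Hx. assert (Hs := scale_gt0). split.
  - apply Rmult_le_pos; [apply Rabs_pos|lra].
  - unfold Rabs. destruct (Rcase_abs x).
    + apply Rle_trans with (IZR (- fst i)); [rewrite opp_IZR; lra|apply IZR_le; lia].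
    + apply Rle_trans with (IZR (snd i)); [lra|apply IZR_le; lia].
Qed.

Lemma mulzI_correct (i : ival) (n : Z) (x : R) : (0 <= n)%Z ->
  inI i x -> inI (mulzI i n) (x * IZR n).
Proof.
  unfold inI; simpl. intros Hn Hx. apply IZR_le in Hn. rewrite !mult_IZR. nra.
Qed.

Lemma divI_correct (i : ival) (n : Z) (x : R) : (0 < n)%Z ->
  inI i x -> inI (divI i n) (x / IZR n).
Proof.
  unfold inI; simpl. intros Hn Hx. assert (Hn' : 0 < IZR n) by now apply IZR_lt.
  assert (H1 := IZR_div_bounds (fst i) n Hn). assert (H2 := IZR_div_bounds (snd i) n Hn).
  replace (x / IZR n * IZR scale) with (x * IZR scale / IZR n) by (field; lra).
  assert (IZR (fst i) / IZR n <= x * IZR scale / IZR n)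
    by (apply Rmult_le_compat_r; [left; now apply Rinv_0_lt_compat|lra]).
  assert (x * IZR scale / IZR n <= IZR (snd i) / IZR n)
    by (apply Rmult_le_compat_r; [left; now apply Rinv_0_lt_compat|lra]).
  lra.
Qed.

Lemma ratI_correct (a b : Z) : (0 < b)%Z -> inI (ratI a b) (IZR a / IZR b).
Proof.
  intros Hb. unfold inI; simpl. assert (Hb' : 0 < IZR b) by now apply IZR_lt.
  assert (H := IZR_div_bounds (a * scale) b Hb). rewrite mult_IZR in H.
  replace (IZR a / IZR b * IZR scale) with (IZR a * IZR scale / IZR b) by (field; lra). lra.
Qed.

Lemma intI_correct (a : Z) : inI (intI a) (IZR a).
Proof. unfold inI; simpl. rewrite mult_IZR. lra. Qed.

Lemma mulI_correct (i j : ival) (x y : R) : 0 <= x ->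
  inI i x -> inI j y -> inI (mulI i j) (x * y).
Proof.
  unfold inI, mulI; cbn [fst snd]. intros Hx0 Hx Hy. assert (Hs := scale_gt0).
  rewrite !Z.shiftr_div_pow2 by (unfold prec; lia). fold scale.
  assert (Hsz : (0 < scale)%Z) by reflexivity.
  set (a := (if (0 <=? fst j)%Z then fst i else snd i)).
  set (b := (if (0 <=? snd j)%Z then snd i else fst i)).
  assert (H1 := IZR_div_bounds (a * fst j) scale Hsz).
  assert (H2 := IZR_div_bounds (b * snd j) scale Hsz).
  rewrite mult_IZR in H1, H2.
  assert (Hxs : 0 <= x * IZR scale) by (apply Rmult_le_pos; lra).
  assert (Ha : IZR a * IZR (fst j) <= x * IZR scale * IZR (fst j)).
  { unfold a. destruct (Z.leb_spec 0 (fst j)) as [H|H];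
      [apply IZR_le in H|apply IZR_lt in H]; nra. }
  assert (Hb : x * IZR scale * IZR (snd j) <= IZR b * IZR (snd j)).
  { unfold b. destruct (Z.leb_spec 0 (snd j)) as [H|H];
      [apply IZR_le in H|apply IZR_lt in H]; nra. }
  assert (Ha' : IZR a * IZR (fst j) <= x * IZR scale * (y * IZR scale)) by nra.
  assert (Hb' : x * IZR scale * (y * IZR scale) <= IZR b * IZR (snd j)) by nra.
  replace (x * y * IZR scale) with (x * IZR scale * (y * IZR scale) / IZR scale) by (field; lra).
  assert (Hi : 0 <= / IZR scale) by (left; now apply Rinv_0_lt_compat).
  split.
  - eapply Rle_trans; [apply H1|]. now apply Rmult_le_compat_r.
  - eapply Rle_trans; [|apply H2]. now apply Rmult_le_compat_r.
Qed.

(** * Enclosures of logarithms and exponentials *)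

Lemma is_derive_atanh_partial (x : R) (n : nat) : 0 <= x <= / 2 ->
  is_derive (fun x => ln (1 + x) - ln (1 - x) - 2 * rsum (fun i => x ^ (2 * i + 1) / INR (2 * i + 1)) n)
    x (2 * x ^ (2 * n) / (1 - x ^ 2)).
Proof.
  intros Hx.
  assert (E : 2 * x ^ (2 * n) / (1 - x ^ 2)
    = (/ (1 + x) + / (1 - x)) - 2 * rsum (fun i => x ^ (2 * i)) n).
  { assert (G : rsum (fun i => x ^ (2 * i)) n * (1 - x ^ 2) = 1 - x ^ (2 * n)).
    { induction n as [|n IH]; [simpl; ring|].
      rewrite rsum_S, Rmult_plus_distr_r, IH.
      replace (2 * S n)%nat with (2 * n + 2)%nat by lia. rewrite pow_add. ring. }
    assert (1 - x ^ 2 <> 0) by nra.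
    apply (Rmult_eq_reg_r (1 - x ^ 2)); [|assumption].
    rewrite Rmult_minus_distr_r, (Rmult_assoc 2 (rsum _ _)), G. field. repeat split; nra. }
  rewrite E.
  apply (is_derive_minus (fun x => ln (1 + x) - ln (1 - x))
    (fun x => 2 * rsum (fun i => x ^ (2 * i + 1) / INR (2 * i + 1)) n)).
  - auto_derive; [lra|]. field. lra.
  - apply (is_derive_scal (fun x => rsum (fun i => x ^ (2 * i + 1) / INR (2 * i + 1)) n)).
    apply (is_derive_rsum (fun i x => x ^ (2 * i + 1) / INR (2 * i + 1)) (fun i x => x ^ (2 * i))).
    intros k _. rewrite Nat.add_1_r. generalize (2 * k)%nat. intros j.
    assert (INR (S j) <> 0) by (apply not_0_INR; lia).
    auto_derive; [trivial|]. simpl pred. field. assumption.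
Qed.

(** The remainder has derivative [2 x^(2n) / (1 - x^2)], which lies between 0 and [4 x^(2n)] on
    [[0, 1/2]]; monotonicity yields both bounds. *)
Lemma atanh_bound (x : R) (n : nat) : 0 <= x <= / 2 ->
  0 <= ln (1 + x) - ln (1 - x) - 2 * rsum (fun i => x ^ (2 * i + 1) / INR (2 * i + 1)) n
    <= 4 * x ^ (2 * n + 1).
Proof.
  intros Hx.
  set (u := fun x => ln (1 + x) - ln (1 - x) - 2 * rsum (fun i => x ^ (2 * i + 1) / INR (2 * i + 1)) n).
  assert (Hd := fun x => is_derive_atanh_partial x n). fold u in Hd.
  assert (H0 : u 0 = 0).
  { unfold u. rewrite Rplus_0_r, Rminus_0_r, ln_1, (rsum_ext _ (fun _ => 0 * 0)).
    - rewrite rsum_scal. ring.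
    - intros k _. rewrite pow_ne_zero by lia. unfold Rdiv. ring. }
  assert (Hpos : forall x, 0 <= x <= / 2 -> 0 <= 2 * x ^ (2 * n) / (1 - x ^ 2) <= 4 * x ^ (2 * n)).
  { intros y Hy. assert (0 <= y ^ (2 * n)) by (apply pow_le; lra).
    assert (y ^ 2 <= / 4) by nra. split.
    - apply Rmult_le_pos; [lra|]. left. apply Rinv_0_lt_compat. lra.
    - apply Rle_div_l; [lra|]. generalize dependent (y ^ (2 * n)). intros z Hz. nra. }
  change (0 <= u x <= 4 * x ^ (2 * n + 1)). split.
  - rewrite <- H0. apply (derive_ge0_le u (fun x => 2 * x ^ (2 * n) / (1 - x ^ 2)) (/ 2)); auto.
    intros y Hy. now apply Hpos.
  - set (w := fun x => 4 * x ^ (2 * n + 1) - u x).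
    assert (A : w 0 <= w x).
    { apply (derive_ge0_le w (fun x => 4 * (INR (2 * n + 1) * x ^ (2 * n)) - 2 * x ^ (2 * n) / (1 - x ^ 2)) (/ 2)); auto.
      - intros y Hy. apply (is_derive_minus (fun x => 4 * x ^ (2 * n + 1)) u); auto.
        rewrite Nat.add_1_r. generalize (2 * n)%nat. intros j.
        auto_derive; [trivial|]. change (4 * (1 * (INR (S j) * y ^ j)) = 4 * (INR (S j) * y ^ j)). ring.
      - intros y Hy. specialize (Hpos y Hy).
        assert (1 <= INR (2 * n + 1)) by (apply (le_INR 1); lia).
        assert (0 <= y ^ (2 * n)) by (apply pow_le; lra). nra. }
    unfold w in A. rewrite H0, pow_ne_zero in A by lia. lra.
Qed.

(** At stage [j] the interval [q] encloses [d^(-(2j + 1))], with [k = 2j + 1], so every operation is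
    a division by an integer. The base case is half the tail bound of [atanh_bound], as [lnstepI]
    doubles the result. *)
Fixpoint atanhI (n : nat) (d2 k : Z) (q : ival) : ival :=
  match n with
  | O => (0%Z, (2 * snd q)%Z)
  | S n => addI (divI q k) (atanhI n d2 (k + 2) (divI q d2))
  end.

Lemma atanhI_correct (d : Z) (n j : nat) (q : ival) (r : R) : (0 < d)%Z ->
  inI q ((/ IZR d) ^ (2 * j + 1)) -> 0 <= r <= 2 * (/ IZR d) ^ (2 * (j + n) + 1) ->
  inI (atanhI n (d * d) (2 * Z.of_nat j + 1) q)
    (rsum (fun i => (/ IZR d) ^ (2 * (j + i) + 1) / INR (2 * (j + i) + 1)) n + r).
Proof.
  intros Hd. assert (Hd' : 0 < IZR d) by now apply IZR_lt.
  revert j q. induction n as [|n IH]; intros j q Hq Hr.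
  - simpl rsum. rewrite Nat.add_0_r in Hr. rewrite Rplus_0_l.
    unfold inI in *; cbn [atanhI fst snd]. rewrite mult_IZR. assert (Hs := scale_gt0).
    split; [apply Rmult_le_pos; lra|]. nra.
  - rewrite rsum_split_first, Nat.add_0_r, Rplus_assoc. cbn [atanhI].
    apply addI_correct.
    + replace (INR (2 * j + 1)) with (IZR (2 * Z.of_nat j + 1)).
      * apply divI_correct; [lia|exact Hq].
      * rewrite INR_IZR_INZ. f_equal. lia.
    + replace (2 * Z.of_nat j + 1 + 2)%Z with (2 * Z.of_nat (S j) + 1)%Z by lia.
      rewrite (rsum_ext _ (fun i => (/ IZR d) ^ (2 * (S j + i) + 1) / INR (2 * (S j + i) + 1)))
        by (intros i _; replace (j + S i)%nat with (S j + i)%nat by lia; reflexivity).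
      apply IH.
      * replace ((/ IZR d) ^ (2 * S j + 1)) with ((/ IZR d) ^ (2 * j + 1) / IZR (d * d)).
        -- apply divI_correct; [lia|exact Hq].
        -- replace (2 * S j + 1)%nat with (2 * j + 1 + 2)%nat by lia.
           rewrite (pow_add _ (2 * j + 1)), mult_IZR. field. lra.
      * replace (S j + n)%nat with (j + S n)%nat by lia. exact Hr.
Qed.

(** Enclosure of [ln ((d + 1) / (d - 1))]. *)
Definition lnstepI (d : Z) : ival :=
  mulzI (atanhI (Z.to_nat (90 / Z.log2 d)) (d * d) 1 (ratI 1 d)) 2.

Lemma lnstepI_correct (d : Z) : (2 <= d)%Z ->
  inI (lnstepI d) (ln (IZR d + 1) - ln (IZR d - 1)).
Proof.
  intros Hd. assert (Hd' : 2 <= IZR d) by now apply IZR_le.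
  assert (Hx : 0 <= / IZR d <= / 2).
  { split; [left; apply Rinv_0_lt_compat; lra|apply Rinv_le_contravar; lra]. }
  (* The enclosure is valid for any number of terms; this choice brings the tail below the unit
     [2^(-176)] for the values of [d] that occur. *)
  unfold lnstepI. set (n := Z.to_nat (90 / Z.log2 d)).
  assert (B := atanh_bound (/ IZR d) n Hx).
  replace (ln (IZR d + 1) - ln (IZR d - 1)) with (ln (1 + / IZR d) - ln (1 - / IZR d)).
  2: { replace (1 + / IZR d) with ((IZR d + 1) / IZR d) by (field; lra).
       replace (1 - / IZR d) with ((IZR d - 1) / IZR d) by (field; lra).
       rewrite !ln_div by lra. ring. }
  set (L := ln (1 + / IZR d) - ln (1 - / IZR d)) in *.
  set (Q := rsum (fun i => (/ IZR d) ^ (2 * i + 1) / INR (2 * i + 1)) n) in *.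
  replace L with ((Q + (L - 2 * Q) / 2) * IZR 2) by field.
  apply mulzI_correct; [lia|].
  apply (atanhI_correct d n 0); [lia| |].
  - simpl. rewrite Rmult_1_r. replace (/ IZR d) with (IZR 1 / IZR d) by (field; lra).
    apply ratI_correct. lia.
  - rewrite Nat.add_0_l. lra.
Qed.

(** The innermost [acc] encloses the factor [w] of the remainder [w x^n / n!], so the truncation
    error travels through the same Horner scheme. *)
Fixpoint hornerI (n : nat) (z acc : ival) : ival :=
  match n with
  | O => acc
  | S m => hornerI m z (addI (intI 1) (divI (mulI z acc) (Z.of_nat n)))
  end.

(** The start [[-2, 2]] is the range of [w] in [exp_taylor_remainder]. The arguments in the final
    evaluation are below 1/4, where 32 terms leave less than [2^(-180)]. *)
Definition expI (z : ival) : ival := hornerI 32 z ((-2 * scale)%Z, (2 * scale)%Z).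

Lemma hornerI_correct (n : nat) (z acc : ival) (x w : R) : 0 <= x ->
  inI z x -> inI acc w ->
  inI (hornerI n z acc)
    (rsum (fun j => 1 * (x ^ j / INR (fact j))) n + w * (x ^ n / INR (fact n))).
Proof.
  intros Hx Hz. revert acc w. induction n as [|n IH]; intros acc w Hw.
  - simpl. replace (0 + w * (1 / 1)) with w by field. exact Hw.
  - cbn [hornerI].
    assert (A : inI (addI (intI 1) (divI (mulI z acc) (Z.of_nat (S n)))) (1 + x * w / INR (S n))).
    { apply addI_correct; [apply intI_correct|]. rewrite INR_IZR_INZ.
      apply divI_correct; [lia|]. now apply mulI_correct. }
    apply IH in A.
    match type of A with inI _ ?a => match goal with |- inI _ ?b => replace b with a; [exact A|] end end.
    rewrite rsum_S, fact_simpl, mult_INR. simpl pow. field.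
    split; [apply INR_fact_neq_0|apply not_0_INR; lia].
Qed.

Lemma exp_taylor_remainder (x : R) (n : nat) : 0 <= x <= / 2 ->
  exists w, -2 <= w <= 2 /\
    exp x = rsum (fun j => 1 * (x ^ j / INR (fact j))) (S n) + w * (x ^ S n / INR (fact (S n))).
Proof.
  intros Hx.
  assert (T := taylor_bound (fun _ => exp) (/ 2) 2 (S n)).
  assert (He : exp (/ 2) <= 2).
  { assert (H := exp_ineq1_le (- / 2)). rewrite exp_Ropp in H.
    assert (P := exp_pos (/ 2)). apply (Rmult_le_compat_r (exp (/ 2))) in H; [|lra].
    rewrite Rinv_l in H by lra. lra. }
  specialize (T (fun j h _ _ => is_derive_exp h)).
  assert (Hb : forall h, 0 <= h <= / 2 -> Rabs (exp h) <= 2).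
  { intros h Hh. rewrite Rabs_pos_eq by (left; apply exp_pos).
    eapply Rle_trans; [|exact He]. apply exp_le. lra. }
  specialize (T Hb x Hx). cbv beta in T. rewrite exp_0 in T.
  set (s := rsum (fun j => 1 * (x ^ j / INR (fact j))) (S n)) in *.
  (* At [x = 0] the quotient defining [w] degenerates, but there the Taylor bound forces
     equality. *)
  destruct (Req_dec x 0) as [E|E].
  - exists 0. split; [lra|]. rewrite E, (pow_ne_zero (S n)) in T by lia.
    unfold Rdiv in T. rewrite Rmult_0_l, Rmult_0_r in T.
    assert (P := Rabs_pos (exp 0 - s)).
    assert (Z0 : exp 0 - s = 0).
    { destruct (Req_dec (exp 0 - s) 0) as [Z|Z]; [exact Z|apply Rabs_pos_lt in Z; lra]. }
    rewrite E. lra.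
  - set (q := x ^ S n / INR (fact (S n))) in *.
    assert (P : 0 < q).
    { apply Rdiv_lt_0_compat; [apply pow_lt; lra|apply INR_fact_lt_0]. }
    exists ((exp x - s) / q). split.
    + apply Rabs_le_between in T. split.
      * apply Rle_div_r; lra.
      * apply Rle_div_l; lra.
    + field. lra.
Qed.

Lemma expI_correct (z : ival) (x : R) : 0 <= x <= / 2 -> inI z x -> inI (expI z) (exp x).
Proof.
  intros Hx Hz.
  destruct (exp_taylor_remainder x 31 Hx) as (w & Hw & ->).
  apply hornerI_correct; [lra|exact Hz|].
  unfold inI; cbn [fst snd]. rewrite !mult_IZR. assert (Hs := scale_gt0).
  split; apply Rmult_le_compat_r; lra.
Qed.

(** [conv l (S i)] is [sum_j l_j sym_coef (i + 1 + j) / sym_coef i], in Horner form. *)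
Fixpoint conv (l : list R) (i : nat) : R :=
  match l with
  | [] => 0
  | x :: l => (x + conv l (S i)) / IZR (8 * Z.of_nat i * (2 * Z.of_nat i + 1))
  end.

Fixpoint convI (l : list ival) (i : nat) : ival :=
  match l with
  | [] => intI 0
  | x :: l => divI (addI x (convI l (S i))) (8 * Z.of_nat i * (2 * Z.of_nat i + 1))
  end.

(** The coefficients [B_{2k}(1/2) / (2k)!] of the midpoint Euler-Maclaurin formula,
    for [k = n] down to [0]. *)
Fixpoint betas (n : nat) : list R :=
  match n with
  | O => [1]
  | S n => - conv (betas n) 1 :: betas n
  end.

Fixpoint betasI (n : nat) : list ival :=
  match n with
  | O => [intI 1]
  | S n => let l := betasI n in oppI (convI l 1) :: l
  end.

Definition beta (n : nat) : R := hd 0 (betas n).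

Lemma convI_correct (li : list ival) (l : list R) (i : nat) :
  Forall2 inI li l -> inI (convI li (S i)) (conv l (S i)).
Proof.
  intros H. revert i. induction H as [|x y li l Hx Hl IH]; intros i.
  - apply intI_correct.
  - cbn [conv convI]. apply divI_correct; [lia|]. apply addI_correct; auto.
Qed.

Lemma betasI_correct (n : nat) : Forall2 inI (betasI n) (betas n).
Proof.
  induction n as [|n IH]; simpl; constructor; auto.
  - apply intI_correct.
  - now apply oppI_correct, convI_correct.
Qed.

Lemma sym_coef_S (i : nat) :
  sym_coef (S i) = sym_coef i / IZR (8 * Z.of_nat (S i) * (2 * Z.of_nat (S i) + 1)).
Proof.
  unfold sym_coef. replace (2 * S i + 1)%nat with (S (S (2 * i + 1))) by lia.
  rewrite !fact_simpl, !mult_INR.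
  replace (IZR (8 * Z.of_nat (S i) * (2 * Z.of_nat (S i) + 1)))
    with (4 * (INR (S (2 * i + 1)) * INR (S (S (2 * i + 1))))).
  - assert (INR (S (2 * i + 1)) <> 0) by (apply not_0_INR; lia).
    assert (INR (S (S (2 * i + 1))) <> 0) by (apply not_0_INR; lia).
    simpl pow. field.
    repeat split; auto; [apply INR_fact_neq_0|apply pow_nonzero; lra].
  - rewrite !INR_IZR_INZ, <- !mult_IZR. f_equal. lia.
Qed.

(** The parameter [f] serves twice: the identity gives the recurrence for [beta], and [Rabs] gives
    the error coefficient [em_defect]. *)
Lemma conv_betas (f : R -> R) (n i : nat) :
  sym_coef i * conv (map f (betas n)) (S i)
  = rsum (fun k => f (beta k) * sym_coef (n - k + S i)) (S n).
Proof.
  revert i. induction n as [|n IH]; intros i.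
  - cbn [betas map conv rsum]. rewrite Nat.sub_0_r, Nat.add_0_l, sym_coef_S.
    unfold beta; simpl hd. unfold Rdiv. ring.
  - rewrite rsum_S, Nat.sub_diag, Nat.add_0_l.
    rewrite (rsum_ext _ (fun k => f (beta k) * sym_coef (n - k + S (S i)))).
    + rewrite <- IH. cbn [betas map conv]. rewrite (sym_coef_S i).
      unfold beta; cbn [betas hd]. unfold Rdiv. ring.
    + intros k Hk. f_equal. f_equal. lia.
Qed.

Lemma sym_coef_0 : sym_coef 0 = 1.
Proof. unfold sym_coef. simpl. field. Qed.

Lemma beta_recurrence (i : nat) : (0 < i)%nat ->
  rsum (fun k => beta k * sym_coef (i - k)) (S i) = 0.
Proof.
  intros Hi. destruct i as [|i]; [lia|].
  rewrite rsum_S, Nat.sub_diag, sym_coef_0.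
  rewrite (rsum_ext _ (fun k => beta k * sym_coef (i - k + 1)))
    by (intros k Hk; f_equal; f_equal; lia).
  rewrite <- (conv_betas (fun x => x)), map_id, sym_coef_0.
  unfold beta; cbn [betas hd]. ring.
Qed.

Lemma em_defect_conv (n : nat) : em_defect beta (S n) = conv (map Rabs (betas n)) 1.
Proof.
  rewrite <- (Rmult_1_l (conv _ _)), <- sym_coef_0, conv_betas.
  unfold em_defect. apply rsum_ext. intros k Hk. f_equal. f_equal. lia.
Qed.

(** * Evaluation of the Euler-Maclaurin approximation at a rational point *)

Definition rhoI (pI : ival) (k : nat) : ival :=
  divI (mulI (addI pI (intI (2 * Z.of_nat k))) (addI pI (intI (2 * Z.of_nat k + 1)))) 1024.

Fixpoint em_hornerI (pI : ival) (l : list ival) (k : nat) (acc : ival) : ival :=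
  match l with
  | [] => acc
  | x :: l => em_hornerI pI l (pred k) (addI x (mulI (rhoI pI k) acc))
  end.

Lemma rhoI_correct (pI : ival) (p : R) (k : nat) : 0 <= p -> inI pI p ->
  inI (rhoI pI k) ((p + INR (2 * k)) * (p + INR (2 * k + 1)) / 1024).
Proof.
  intros Hp HpI. apply divI_correct; [lia|].
  apply mulI_correct.
  - assert (H := pos_INR (2 * k)). lra.
  - apply addI_correct; [exact HpI|].
    replace (INR (2 * k)) with (IZR (2 * Z.of_nat k)); [apply intI_correct|].
    rewrite INR_IZR_INZ. f_equal. lia.
  - apply addI_correct; [exact HpI|].
    replace (INR (2 * k + 1)) with (IZR (2 * Z.of_nat k + 1)); [apply intI_correct|].
    rewrite INR_IZR_INZ. f_equal. lia.
Qed.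

(** Horner evaluation at [x = 32]: [rhoI] is the ratio of consecutive factors, with [1024 = 32^2],
    and [betasI] lists the coefficients from the highest down, in the order the scheme consumes
    them. *)
Lemma em_hornerI_correct (pI acc : ival) (p w : R) (n : nat) : 0 <= p -> inI pI p ->
  inI acc w ->
  inI (em_hornerI pI (betasI n) n acc)
    (rsum (fun k => beta k * (poch p (2 * k) / 1024 ^ k)) (S n)
      + poch p (2 * S n) / 1024 ^ S n * w).
Proof.
  intros Hp HpI. revert acc w.
  assert (Hstep : forall k, poch p (2 * S k)
    = poch p (2 * k) * ((p + INR (2 * k)) * (p + INR (2 * k + 1)))).
  { intros k. replace (2 * S k)%nat with (S (S (2 * k))) by lia. cbn [poch].
    rewrite (Nat.add_1_r (2 * k)). ring. }
  induction n as [|n IH]; intros acc w Hw.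
  - cbn [betasI em_hornerI].
    replace (rsum (fun k => beta k * (poch p (2 * k) / 1024 ^ k)) 1 + poch p (2 * 1) / 1024 ^ 1 * w)
      with (1 + (p + INR (2 * 0)) * (p + INR (2 * 0 + 1)) / 1024 * w).
    + apply addI_correct; [apply intI_correct|].
      apply mulI_correct; [|now apply rhoI_correct|exact Hw].
      simpl. nra.
    + rewrite Hstep. cbn [rsum]. unfold beta; simpl. field.
  - cbn [betasI em_hornerI pred].
    set (z := - conv (betas n) 1 + (p + INR (2 * S n)) * (p + INR (2 * S n + 1)) / 1024 * w).
    assert (Hz : inI (addI (oppI (convI (betasI n) 1)) (mulI (rhoI pI (S n)) acc)) z).
    { apply addI_correct; [apply oppI_correct, convI_correct, betasI_correct|].
      apply mulI_correct; [|now apply rhoI_correct|exact Hw].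
      assert (H1 := pos_INR (2 * S n)). assert (H2 := pos_INR (2 * S n + 1)).
      assert (0 <= (p + INR (2 * S n)) * (p + INR (2 * S n + 1))) by (apply Rmult_le_pos; lra). lra. }
    apply IH in Hz.
    match type of Hz with inI _ ?a => match goal with |- inI _ ?b => replace b with a; [exact Hz|] end end.
    rewrite (rsum_S _ (S n)), (Hstep (S n)). unfold z.
    replace (beta (S n)) with (- conv (betas n) 1) by reflexivity.
    rewrite <- !tech_pow_Rmult. field. apply pow_nonzero. lra.
Qed.

(** The logarithm is carried from [k] to [k + 2] through [ln ((d + 1) / (d - 1))] with [d = k + 1].
    Powers are formed as [exp ((2 - sigma) ln (k + 2)) / (k + 2)^2], which keeps the exponent small
    and nonnegative, as [expI] and [mulI] require. *)
Fixpoint oddsumI (c : nat) (deltaI : ival) (k : Z) (l : ival) : ival :=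
  match c with
  | O => intI 0
  | S c => let l' := addI l (lnstepI (k + 1)) in
           addI (divI (expI (mulI deltaI l')) ((k + 2) * (k + 2))) (oddsumI c deltaI (k + 2) l')
  end.

(** Together with [2 - sigma <= 1/12], whence the bound 23/12 on [sigma], this keeps the arguments
    of [expI] in [[0, 1/2]]. *)
Lemma ln_le_6 (k : Z) : (0 < k <= 64)%Z -> ln (IZR k) <= 6.
Proof.
  intros [H1 H2]. apply IZR_lt in H1. apply IZR_le in H2.
  apply Rle_trans with (ln (2 ^ 6)).
  - apply ln_le; [exact H1|]. lra.
  - rewrite ln_pow by lra. assert (H := ln_lt_2). simpl INR.
    assert (ln 2 <= 1); [|lra].
    rewrite <- (ln_exp 1). apply ln_le; [lra|]. assert (E := exp_ineq1_le 1). lra.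
Qed.

Lemma oddsumI_correct (c : nat) (deltaI l : ival) (sigma : R) (k : Z) :
  0 <= 2 - sigma <= / 12 -> inI deltaI (2 - sigma) -> (0 < k)%Z -> (k + 2 * Z.of_nat c <= 64)%Z ->
  inI l (ln (IZR k)) ->
  inI (oddsumI c deltaI k l)
    (rsum (fun j => exp (- sigma * ln (IZR (k + 2 + 2 * Z.of_nat j)))) c).
Proof.
  intros Hs HdI. revert k l. induction c as [|c IH]; intros k l Hk Hc Hl.
  - apply intI_correct.
  - assert (Hk' : 0 < IZR k) by now apply IZR_lt.
    assert (Hl' : inI (addI l (lnstepI (k + 1))) (ln (IZR (k + 2)))).
    { replace (ln (IZR (k + 2))) with
        (ln (IZR k) + (ln (IZR (k + 1) + 1) - ln (IZR (k + 1) - 1))).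
      - apply addI_correct; [exact Hl|]. apply lnstepI_correct. lia.
      - rewrite !plus_IZR. replace (IZR k + 1 + 1) with (IZR k + 2) by ring.
        replace (IZR k + 1 - 1) with (IZR k) by ring. ring. }
    rewrite rsum_split_first. cbn [oddsumI]. cbv zeta.
    replace (k + 2 + 2 * Z.of_nat 0)%Z with (k + 2)%Z by lia.
    apply addI_correct.
    + assert (H2 : 0 < IZR (k + 2)) by (apply IZR_lt; lia).
      assert (L0 : 0 <= ln (IZR (k + 2))).
      { rewrite <- ln_1. apply ln_le; [lra|]. apply IZR_le. lia. }
      assert (L6 := ln_le_6 (k + 2) ltac:(lia)).
      replace (exp (- sigma * ln (IZR (k + 2)))) with
        (exp ((2 - sigma) * ln (IZR (k + 2))) / IZR ((k + 2) * (k + 2))).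
      * apply divI_correct; [nia|]. apply expI_correct; [nra|].
        apply mulI_correct; [lra|exact HdI|exact Hl'].
      * replace ((2 - sigma) * ln (IZR (k + 2)))
          with (- sigma * ln (IZR (k + 2)) + (ln (IZR (k + 2)) + ln (IZR (k + 2)))) by ring.
        rewrite !exp_plus, exp_ln, mult_IZR by exact H2. field. lra.
    + rewrite (rsum_ext _ (fun j => exp (- sigma * ln (IZR (k + 2 + 2 + 2 * Z.of_nat j)))))
        by (intros j _; do 4 f_equal; lia).
      apply IH; [lia|lia|exact Hl'].
Qed.

Definition ln2I : ival := lnstepI 3.

(** Enclosure of [2^(-sigma)] times the Euler-Maclaurin approximation, with cut-off [32]
    and [n + 1] terms, of [sum (m + 3/2)^(-sigma)], where [sigma = a / b]. *)
Definition totalI (a b : Z) (n : nat) : ival :=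
  let deltaI := ratI (2 * b - a) b in
  let pI := ratI (a - b) b in
  addI (oddsumI 31 deltaI 1 (intI 0))
    (mulI (divI (expI (mulI deltaI (mulzI ln2I 6))) 128)
       (mulI (ratI b (a - b)) (em_hornerI pI (betasI n) n (intI 0)))).

Definition two_powI (a b : Z) : ival := divI (expI (mulI (ratI (2 * b - a) b) ln2I)) 4.

Fixpoint Zfact (n : nat) : Z :=
  match n with O => 1%Z | S m => (Zfact m * Z.of_nat n)%Z end.

(** Bounding [poch p (2n + 3)] by [(2n + 3)!], valid for [0 <= p <= 1], makes the error bound
    independent of [sigma]. *)
Definition errI (n : nat) : ival :=
  divI (mulzI (convI (map absI (betasI n)) 1) (Zfact (2 * S n + 1)))
       (32 ^ Z.of_nat (2 * n + 1) * 31).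

Lemma ln2I_correct : inI ln2I (ln 2).
Proof.
  assert (H := lnstepI_correct 3 ltac:(lia)).
  replace (ln 2) with (ln (3 + 1) - ln (3 - 1)); [exact H|].
  replace (3 + 1) with (2 * 2) by ring. replace (3 - 1) with 2 by ring.
  rewrite ln_mult by lra. ring.
Qed.

Lemma ln2_bounds : 0 < ln 2 <= 1.
Proof.
  split.
  - rewrite <- ln_1. apply ln_increasing; lra.
  - rewrite <- (ln_exp 1). apply ln_le; [lra|]. assert (E := exp_ineq1_le 1). lra.
Qed.

Lemma poch_le_Zfact (p : R) (n : nat) : 0 <= p <= 1 -> 0 <= poch p n <= IZR (Zfact n).
Proof.
  intros Hp. induction n as [|n IH]; cbn [poch Zfact]; [lra|].
  rewrite mult_IZR, <- INR_IZR_INZ, S_INR. assert (H := pos_INR n).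
  split; [apply Rmult_le_pos; lra|]. apply Rmult_le_compat; lra.
Qed.

Lemma em_main_32 (p : R) (n : nat) :
  em_main beta p n 32 = negpow p 32 * rsum (fun k => beta k * (poch p (2 * k) / 1024 ^ k)) n.
Proof.
  unfold em_main. rewrite <- rsum_scal. apply rsum_ext. intros k _.
  replace (negpow (p + INR (2 * k)) 32) with (negpow p 32 * / 1024 ^ k).
  - unfold Rdiv. ring.
  - replace 1024 with (32 ^ 2) by ring. rewrite <- pow_mult, <- negpow_INR by lra.
    unfold negpow. rewrite <- exp_plus. f_equal. ring.
Qed.

Lemma errI_correct (n : nat) :
  inI (errI n) (em_defect beta (S n) * IZR (Zfact (2 * S n + 1))
    / IZR (32 ^ Z.of_nat (2 * n + 1) * 31)).
Proof.
  unfold errI. apply divI_correct; [lia|]. apply mulzI_correct.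
  - apply le_IZR. eapply Rle_trans; apply (poch_le_Zfact 0); lra.
  - rewrite em_defect_conv. apply convI_correct.
    induction (betasI_correct n); simpl; constructor; auto using absI_correct.
Qed.

Lemma two_powI_correct (a b : Z) : (0 < b)%Z -> 23 / 12 <= IZR a / IZR b <= 2 ->
  inI (two_powI a b) (exp (- (IZR a / IZR b) * ln 2)).
Proof.
  intros Hb Hs. assert (Hb' : 0 < IZR b) by now apply IZR_lt.
  assert (L := ln2_bounds). set (sigma := IZR a / IZR b) in *.
  replace (exp (- sigma * ln 2)) with (exp ((2 - sigma) * ln 2) / IZR 4).
  - apply divI_correct; [lia|]. apply expI_correct; [nra|].
    apply mulI_correct; [lra| |apply ln2I_correct].
    replace (2 - sigma) with (IZR (2 * b - a) / IZR b); [now apply ratI_correct|].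
    unfold sigma. rewrite minus_IZR, mult_IZR. field. lra.
  - replace ((2 - sigma) * ln 2) with (- sigma * ln 2 + (ln 2 + ln 2)) by ring.
    rewrite !exp_plus, exp_ln by lra. field.
Qed.

(** Scaling by [2^(-sigma)] turns the 31 explicit half-integers into the odd numbers 3 to 63, and
    later turns the comparison of the sum with 1 into one with [2^(-sigma)]. *)
Lemma totalI_correct (a b : Z) (n : nat) (v : R) :
  (0 < b)%Z -> 23 / 12 <= IZR a / IZR b < 2 ->
  is_series (fun m => exp (- half_ln m * (IZR a / IZR b))) v ->
  exists e, Rabs e * IZR scale <= IZR (snd (errI n)) /\
    inI (totalI a b n) (exp (- (IZR a / IZR b) * ln 2) * v + e).
Proof.
  intros Hb Hs Hv. assert (Hb' : 0 < IZR b) by now apply IZR_lt.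
  assert (L := ln2_bounds). set (sigma := IZR a / IZR b) in *.
  set (p := sigma - 1). set (t := exp (- sigma * ln 2)).
  assert (Hd : inI (ratI (2 * b - a) b) (2 - sigma)).
  { replace (2 - sigma) with (IZR (2 * b - a) / IZR b); [now apply ratI_correct|].
    unfold sigma. rewrite minus_IZR, mult_IZR. field. lra. }
  assert (Hp : inI (ratI (a - b) b) p).
  { replace p with (IZR (a - b) / IZR b); [now apply ratI_correct|].
    unfold p, sigma. rewrite minus_IZR. field. lra. }
  assert (Hab : IZR a - IZR b = p * IZR b) by (unfold p, sigma; field; lra).
  assert (Hab0 : 0 < IZR a - IZR b) by (rewrite Hab; apply Rmult_lt_0_compat; unfold p; lra).
  assert (Hip : inI (ratI b (a - b)) (/ p)).
  { replace (/ p) with (IZR b / IZR (a - b)).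
    - apply ratI_correct. apply lt_IZR. rewrite minus_IZR. exact Hab0.
    - rewrite minus_IZR. unfold p, sigma. field. lra. }
  assert (Hex : ex_series (fun m => exp (- half_ln m * sigma))) by now exists v.
  set (v' := Series (fun j => exp (- half_ln (31 + j) * sigma))).
  assert (Hv' : is_series (fun j => negpow (p + 1) (INR (32 + j) + / 2)) v').
  { apply (is_series_ext (fun j => exp (- half_ln (31 + j) * sigma))).
    - intros j. unfold negpow, half_ln, p.
      replace (INR (31 + j) + 3 / 2) with (INR (32 + j) + / 2)
        by (replace (32 + j)%nat with (S (31 + j)) by lia; rewrite S_INR; lra).
      f_equal. ring.
    - apply Series_correct. apply (ex_series_incr_n (fun m => exp (- half_ln m * sigma))), Hex. }
  assert (Hsplit : v = rsum (fun m => exp (- half_ln m * sigma)) 31 + v').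
  { rewrite <- (is_series_unique _ _ Hv), (Series_incr_n _ 31) by (lia || exact Hex).
    f_equal. rewrite <- sum_n_Reals. apply sum_n_rsum. }
  assert (EM := em_series beta p v' n 32 ltac:(unfold p; lra) ltac:(lia) eq_refl
    (fun i Hi => beta_recurrence i (proj1 Hi)) Hv').
  replace (INR 32) with 32 in EM by (simpl; ring).
  rewrite em_main_32 in EM.
  set (br := rsum (fun k => beta k * (poch p (2 * k) / 1024 ^ k)) (S n)) in *.
  (* As [2^(-sigma) <= 1/2 <= p], the factor [t / p] of the scaled error is at most 1. *)
  assert (Ht : 0 < t <= p).
  { split; [apply exp_pos|]. apply Rle_trans with (exp (- ln 2)).
    - apply exp_le. nra.
    - rewrite exp_Ropp, exp_ln by lra. unfold p. lra. }
  exists (t * (negpow p 32 * br - p * v') / p). split.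
  - apply Rle_trans with (Rabs (p * v' - negpow p 32 * br) * IZR scale).
    + apply Rmult_le_compat_r; [left; apply scale_gt0|].
      replace (t * (negpow p 32 * br - p * v') / p)
        with (t / p * (negpow p 32 * br - p * v')) by (field; lra).
      rewrite Rabs_mult, (Rabs_minus_sym (p * v')).
      rewrite <- (Rmult_1_l (Rabs (negpow p 32 * br - p * v'))) at 2.
      apply Rmult_le_compat_r; [apply Rabs_pos|].
      assert (0 < t / p) by (apply Rdiv_lt_0_compat; lra).
      rewrite Rabs_pos_eq by lra. apply Rle_div_l; lra.
    + eapply Rle_trans; [|apply (errI_correct n)].
      apply Rmult_le_compat_r; [left; apply scale_gt0|].
      eapply Rle_trans; [exact EM|].
      rewrite mult_IZR, <- pow_IZR. unfold Rdiv. rewrite Rinv_mult, <- !Rmult_assoc.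
      replace (32 - 1) with 31 by ring.
      apply Rmult_le_compat_r; [lra|].
      apply Rmult_le_compat_r; [left; apply Rinv_0_lt_compat, pow_lt; lra|].
      apply Rmult_le_compat_l; [apply em_defect_ge0|].
      apply poch_le_Zfact. unfold p. lra.
  - rewrite Hsplit.
    replace (t * (rsum (fun m => exp (- half_ln m * sigma)) 31 + v') + t * (negpow p 32 * br - p * v') / p)
      with (rsum (fun j => exp (- sigma * ln (IZR (1 + 2 + 2 * Z.of_nat j)))) 31
        + exp ((2 - sigma) * (ln 2 * IZR 6)) / IZR 128 * (/ p * br)).
    + unfold totalI. cbv zeta. apply addI_correct.
      * apply oddsumI_correct; [lra|exact Hd|lia|lia|].
        rewrite ln_1. apply intI_correct.
      * apply mulI_correct.
        -- left. apply Rdiv_lt_0_compat; [apply exp_pos|lra].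
        -- apply divI_correct; [lia|]. apply expI_correct; [nra|].
           apply mulI_correct; [lra|exact Hd|]. apply mulzI_correct; [lia|apply ln2I_correct].
        -- apply mulI_correct; [left; apply Rinv_0_lt_compat; unfold p; lra|exact Hip|].
           assert (E := em_hornerI_correct _ _ p 0 n ltac:(unfold p; lra) Hp (intI_correct 0)).
           rewrite Rmult_0_r, Rplus_0_r in E. exact E.
    + rewrite (rsum_ext _ (fun m => t * exp (- half_ln m * sigma))), rsum_scal.
      (* Here [2^(-sigma) 32^(-p) = 2^(5 - 6 sigma) = 2^(6 (2 - sigma)) / 2^7]. *)
      * replace (exp ((2 - sigma) * (ln 2 * IZR 6)) / IZR 128) with (t * negpow p 32).
        -- field. unfold p. lra.
        -- unfold t, negpow. rewrite <- exp_plus.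
           replace 32 with (2 ^ 5) by ring. rewrite ln_pow by lra.
           replace (IZR 128) with (exp (INR 7 * ln 2)).
           ++ unfold Rdiv. rewrite <- exp_Ropp, <- exp_plus. f_equal. unfold p. simpl INR. ring.
           ++ rewrite <- ln_pow, exp_ln by lra. ring.
      * intros m _. unfold t. rewrite <- exp_plus. f_equal. rewrite half_ln_odd.
        replace (INR (2 * S m + 1)) with (IZR (1 + 2 + 2 * Z.of_nat m)); [ring|].
        rewrite INR_IZR_INZ. f_equal. lia.
Qed.

Lemma ival_gt (T U E : ival) (t v e : R) : (snd U + snd E <? fst T)%Z = true ->
  Rabs e * IZR scale <= IZR (snd E) -> inI T (t * v + e) -> inI U t -> 0 < t -> 1 < v.
Proof.
  unfold inI. assert (Hs := scale_gt0). revert Hs. generalize (IZR scale).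
  intros s Hs H He HT HU Ht. apply Z.ltb_lt in H. apply IZR_lt in H. rewrite plus_IZR in H.
  assert (A := Rle_abs e). assert (e * s <= Rabs e * s) by (apply Rmult_le_compat_r; lra).
  assert (H1 : s * (t * 1) < s * (t * v)) by lra.
  apply (Rmult_lt_reg_l s) in H1; [|exact Hs]. now apply (Rmult_lt_reg_l t).
Qed.

Lemma ival_lt (T U E : ival) (t v e : R) : (snd T + snd E <? fst U)%Z = true ->
  Rabs e * IZR scale <= IZR (snd E) -> inI T (t * v + e) -> inI U t -> 0 < t -> v < 1.
Proof.
  unfold inI. assert (Hs := scale_gt0). revert Hs. generalize (IZR scale).
  intros s Hs H He HT HU Ht. apply Z.ltb_lt in H. apply IZR_lt in H. rewrite plus_IZR in H.
  assert (A := Rle_abs (- e)). rewrite Rabs_Ropp in A.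
  assert (- e * s <= Rabs e * s) by (apply Rmult_le_compat_r; lra).
  assert (H1 : s * (t * v) < s * (t * 1)) by lra.
  apply (Rmult_lt_reg_l s) in H1; [|exact Hs]. now apply (Rmult_lt_reg_l t).
Qed.

Lemma check_gt_correct (a b : Z) (n : nat) (v : R) :
  (snd (two_powI a b) + snd (errI n) <? fst (totalI a b n))%Z = true ->
  (0 < b)%Z -> 23 / 12 <= IZR a / IZR b < 2 ->
  is_series (fun m => exp (- half_ln m * (IZR a / IZR b))) v -> 1 < v.
Proof.
  intros Hc Hb Hs Hv. destruct (totalI_correct a b n v Hb Hs Hv) as (e & He & Ht).
  exact (ival_gt (totalI a b n) (two_powI a b) (errI n) _ v e Hc He Ht
    (two_powI_correct a b Hb (conj (proj1 Hs) (Rlt_le _ _ (proj2 Hs)))) (exp_pos _)).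
Qed.

Lemma check_lt_correct (a b : Z) (n : nat) (v : R) :
  (snd (totalI a b n) + snd (errI n) <? fst (two_powI a b))%Z = true ->
  (0 < b)%Z -> 23 / 12 <= IZR a / IZR b < 2 ->
  is_series (fun m => exp (- half_ln m * (IZR a / IZR b))) v -> v < 1.
Proof.
  intros Hc Hb Hs Hv. destruct (totalI_correct a b n v Hb Hs Hv) as (e & He & Ht).
  exact (ival_lt (totalI a b n) (two_powI a b) (errI n) _ v e Hc He Ht
    (two_powI_correct a b Hb (conj (proj1 Hs) (Rlt_le _ _ (proj2 Hs)))) (exp_pos _)).
Qed.

(** With 27 correction terms and cut-off 32 the error bound is below [10^(-50)], well under the
    resolution [10^(-45)]. *)
Lemma check_lower :
  let a := 1940101683743625286017469390525548878230247607%Z in let b := (10 ^ 45)%Z in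
  (snd (two_powI a b) + snd (errI 26) <? fst (totalI a b 26))%Z = true.
Proof. vm_compute. reflexivity. Qed.

Lemma half_sum_lower (v : R) :
  is_series (fun m => exp (- half_ln m * 1.940101683743625286017469390525548878230247607)) v ->
  1 < v.
Proof.
  intros Hv. apply (check_gt_correct _ _ _ _ check_lower); [reflexivity|lra|].
  replace (IZR 1940101683743625286017469390525548878230247607 / IZR (10 ^ 45))
    with (1.940101683743625286017469390525548878230247607) by lra.
  exact Hv.
Qed.

Lemma check_upper :
  let a := 1940101683743625286017469390525548878230247608%Z in let b := (10 ^ 45)%Z in
  (snd (totalI a b 26) + snd (errI 26) <? fst (two_powI a b))%Z = true.
Proof. vm_compute. reflexivity. Qed.

Lemma half_sum_upper (v : R) :
  is_series (fun m => exp (- half_ln m * 1.940101683743625286017469390525548878230247608)) v ->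
  v < 1.
Proof.
  intros Hv. apply (check_lt_correct _ _ _ _ check_upper); [reflexivity|lra|].
  replace (IZR 1940101683743625286017469390525548878230247608 / IZR (10 ^ 45))
    with (1.940101683743625286017469390525548878230247608) by lra.
  exact Hv.
Qed.

(** * The supremum of the real parts *)

(** The value of [1 + sum_m (m + 3/2)^(-s)], by [is_series_half]. *)
Definition half_value (zeta : C -> C) (s : C) : C :=
  Cmult (Cminus (Cexp (Cmult s (RtoC (ln 2)))) (RtoC 1)) (Cminus (zeta s) (RtoC 1)).

Lemma is_series_half_re (zeta : C -> C) (x y : R) : is_riemann_zeta zeta -> 1 < x ->
  is_series (fun m => exp (- half_ln m * x) * cos (half_ln m * y))
    (fst (half_value zeta (x, y)) - 1).
Proof.
  intros Hz Hx.
  eapply is_series_ext; [|exact (is_series_C_fst _ _ (is_series_half zeta (x, y) Hz Hx))].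
  intros m. simpl. f_equal.
  - f_equal. ring.
  - rewrite <- cos_neg. f_equal. ring.
Qed.

Lemma is_series_half_im (zeta : C -> C) (x y : R) : is_riemann_zeta zeta -> 1 < x ->
  is_series (fun m => exp (- half_ln m * x) * sin (half_ln m * y))
    (- snd (half_value zeta (x, y))).
Proof.
  intros Hz Hx.
  replace (- snd (half_value zeta (x, y)))
    with (-1 * snd (Cminus (half_value zeta (x, y)) (RtoC 1))) by (simpl; ring).
  eapply is_series_ext;
    [|exact (is_series_scal (K := R_AbsRing) (V := R_NormedModule) (-1) _ _
        (is_series_C_snd _ _ (is_series_half zeta (x, y) Hz Hx)))].
  intros m. change scal with Rmult. simpl.
  replace (- (x * half_ln m - y * 0)) with (- half_ln m * x) by ring.
  replace (- (x * 0 + y * half_ln m)) with (- (half_ln m * y)) by ring.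
  rewrite sin_neg. ring.
Qed.

(** The modulus [2^x] exceeds 1. Hence the factor [2^s - 1] of [half_value] has no zeros here, and
    every zero of [half_value] is a 1-point. *)
Lemma Cexp_ln2_neq_1 (x y : R) : 0 < x -> Cexp (Cmult (x, y) (RtoC (ln 2))) <> RtoC 1.
Proof.
  intros Hx E. unfold Cexp, RtoC, Cmult in E; simpl in E.
  assert (E1 := f_equal fst E). assert (E2 := f_equal snd E). simpl in E1, E2.
  set (w := exp (x * ln 2 - y * 0)) in *. set (u := x * 0 + y * ln 2) in *.
  assert (Hw : 1 < w).
  { unfold w. rewrite <- exp_0. apply exp_increasing.
    assert (0 < ln 2) by (rewrite <- ln_1; apply ln_increasing; lra). nra. }
  assert (S := sin2_cos2 u). unfold Rsqr in S.
  assert (w * w = 1) by (replace (w * w) with (w * cos u * (w * cos u) + w * sin u * (w * sin u)) by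
    (transitivity (w * w * (sin u * sin u + cos u * cos u)); [ring|rewrite S; ring]);
    rewrite E1, E2; ring).
  nra.
Qed.

Lemma half_value_eq_0 (zeta : C -> C) (x y : R) : 0 < x ->
  half_value zeta (x, y) = RtoC 0 -> zeta (x, y) = RtoC 1.
Proof.
  intros Hx E. apply NNPP. intros Hn. revert E.
  apply Cmult_neq_0; intros E; [apply (Cexp_ln2_neq_1 x y Hx)|apply Hn];
    rewrite <- (Cplus_0_l (RtoC 1)), <- E; ring.
Qed.

Lemma half_value_real (zeta : C -> C) (x : R) :
  half_value zeta (RtoC x) =
  ((Rpower 2 x - 1) * (fst (zeta (RtoC x)) - 1), (Rpower 2 x - 1) * snd (zeta (RtoC x))).
Proof.
  unfold half_value, Cexp, Cminus, Cmult, Cplus, Copp, RtoC, Rpower; simpl.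
  replace (x * ln 2 - 0 * 0) with (x * ln 2) by ring.
  replace (x * 0 + 0 * ln 2) with 0 by ring.
  rewrite cos_0, sin_0. f_equal; ring.
Qed.

Lemma Rpower_2_gt_1 (x : R) : 0 < x -> 1 < Rpower 2 x.
Proof. intros Hx. rewrite <- (Rpower_O 2) by lra. apply Rpower_lt; lra. Qed.

Lemma is_series_half_real (zeta : C -> C) (x : R) : is_riemann_zeta zeta -> 1 < x ->
  is_series (fun m => exp (- half_ln m * x))
    ((Rpower 2 x - 1) * (fst (zeta (RtoC x)) - 1) - 1) /\
  snd (zeta (RtoC x)) = 0.
Proof.
  intros Hz Hx. split.
  - assert (H := is_series_half_re zeta x 0 Hz Hx).
    change (x, 0) with (RtoC x) in H. rewrite half_value_real in H. simpl fst in H.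
    eapply is_series_ext; [|exact H]. intros m. simpl.
    rewrite Rmult_0_r, cos_0. apply Rmult_1_r.
  - assert (H := is_series_half_im zeta x 0 Hz Hx).
    change (x, 0) with (RtoC x) in H. rewrite half_value_real in H. simpl snd in H.
    apply is_series_unique in H.
    rewrite (Series_ext _ (fun m => 0 * exp (- half_ln m * x))), Series_scal_l in H
      by (intros m; rewrite Rmult_0_r, sin_0; ring).
    assert (P := Rpower_2_gt_1 x ltac:(lra)).
    assert (E : (Rpower 2 x - 1) * snd (zeta (RtoC x)) = 0) by lra.
    apply Rmult_integral in E. destruct E; [lra|assumption].
Qed.

Definition half_sum (x : R) : R := Series (fun m => exp (- half_ln m * x)).

Lemma half_sum_eq (zeta : C -> C) (x : R) : is_riemann_zeta zeta -> 1 < x ->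
  half_sum x = (Rpower 2 x - 1) * (fst (zeta (RtoC x)) - 1) - 1.
Proof. intros Hz Hx. apply is_series_unique. now apply is_series_half_real. Qed.

(** Both sides say [(2^x - 1) (zeta x - 1) = 2]; on the real axis [zeta] is real because the sine
    series vanishes termwise. *)
Lemma half_sum_eq_1 (zeta : C -> C) (x : R) : is_riemann_zeta zeta -> 1 < x ->
  half_sum x = 1 <-> zeta (RtoC x) = RtoC ((Rpower 2 x + 1) / (Rpower 2 x - 1)).
Proof.
  intros Hz Hx. rewrite (half_sum_eq zeta x Hz Hx).
  assert (Him := proj2 (is_series_half_real zeta x Hz Hx)).
  assert (P := Rpower_2_gt_1 x ltac:(lra)).
  rewrite (surjective_pairing (zeta (RtoC x))), Him. simpl fst. simpl snd.
  set (w := fst (zeta (RtoC x))). split.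
  - intros E. unfold RtoC. f_equal.
    apply (Rmult_eq_reg_l (Rpower 2 x - 1)); [|lra].
    replace ((Rpower 2 x - 1) * ((Rpower 2 x + 1) / (Rpower 2 x - 1))) with (Rpower 2 x + 1)
      by (field; lra). lra.
  - intros E. apply (f_equal fst) in E. simpl in E. rewrite E. field. lra.
Qed.

Lemma half_sum_decreasing (x x' : R) :
  ex_series (fun m => exp (- half_ln m * x)) -> ex_series (fun m => exp (- half_ln m * x')) ->
  x < x' -> half_sum x' < half_sum x.
Proof.
  intros H H' Hx. unfold half_sum.
  rewrite (Series_incr_1 _ H), (Series_incr_1 _ H').
  apply Rplus_lt_le_compat.
  - apply exp_increasing. assert (P := half_ln_gt0 0). nra.
  - apply Series_le; [|now apply (ex_series_incr_1 (fun m => exp (- half_ln m * x)))].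
    intros n. split; [left; apply exp_pos|].
    apply exp_scale_le; [left; apply half_ln_gt0|lra].
Qed.

(** Continuity is inherited from the differentiability of [zeta] through the closed form of the
    sum. *)
Lemma continuity_pt_half_sum (zeta : C -> C) (x : R) : is_riemann_zeta zeta -> 1 < x ->
  continuity_pt (fun x => (Rpower 2 x - 1) * (fst (zeta (RtoC x)) - 1) - 1) x.
Proof.
  intros Hz Hx.
  assert (Cz : continuous (fun x => fst (zeta (RtoC x))) x).
  { apply (continuous_comp (V := C_UniformSpace) (W := R_UniformSpace) (fun x => zeta (RtoC x)) fst).
    - apply (continuous_comp (U := R_UniformSpace) (V := C_UniformSpace) (W := C_UniformSpace) RtoC zeta).
      + intros P [e He]. exists e. intros y Hy. apply He. split; [exact Hy|].
        apply (ball_center (M := R_UniformSpace)).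
      + assert (D : @ex_derive C_AbsRing C_NormedModule zeta (RtoC x)).
        { apply (proj2 Hz). intros E. apply (f_equal fst) in E. simpl in E. lra. }
        apply ex_derive_continuous in D.
        intros P HP. apply locally_C. exact (D P HP).
    - destruct (zeta (RtoC x)) as [u v].
      apply (continuous_fst (U := R_UniformSpace) (V := R_UniformSpace) u v). }
  apply continuity_pt_filterlim in Cz.
  assert (Cp : continuity_pt (Rpower 2) x).
  { apply derivable_continuous_pt. exists (Rpower 2 x * ln 2).
    apply is_derive_Reals. unfold Rpower. auto_derive; [trivial|ring]. }
  repeat first [apply continuity_pt_minus | apply continuity_pt_mult | exact Cz | exact Cp
    | apply continuity_pt_const; intros ? ?; reflexivity].
Qed.

Lemma zeta_one_near (zeta : C -> C) (sigma0 delta : R) : is_riemann_zeta zeta ->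
  19 / 10 <= sigma0 -> half_sum sigma0 = 1 -> 0 < delta ->
  exists x t, sigma0 - delta <= x /\ 1 < x /\ zeta (x, t) = RtoC 1.
Proof.
  intros Hz Hs0 H1 Hdelta.
  destruct (half_point_near sigma0 delta) as (x & t & Hx & Hx1 & Hre & Him);
    [|exact Hs0|exact H1|exact Hdelta|].
  { intros x Hx. eexists. now apply (is_series_half_real zeta). }
  exists x, t. repeat split; [exact Hx|exact Hx1|].
  apply half_value_eq_0; [lra|].
  assert (A1 := is_series_half_re zeta x t Hz Hx1).
  assert (A2 := is_series_half_im zeta x t Hz Hx1).
  apply is_series_unique in A1, A2, Hre, Him.
  rewrite (surjective_pairing (half_value zeta (x, t))).
  unfold RtoC. f_equal; lra.
Qed.

Theorem theorem4p1 (zeta : C -> C) (Hzeta : is_riemann_zeta zeta) :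
  exists sigma0 : R,
    unique (fun sigma : R =>
              1 < sigma /\
              zeta (RtoC sigma) =
                RtoC ((Rpower 2 sigma + 1) / (Rpower 2 sigma - 1))) sigma0 /\
    sigma_sup zeta (RtoC 1) = Finite sigma0 /\
    1.940101683743625286017469390525548878230247607 <= sigma0
      < 1.940101683743625286017469390525548878230247608.
Proof.
  set (L := 1.940101683743625286017469390525548878230247607).
  set (U := 1.940101683743625286017469390525548878230247608).
  assert (HL : 19 / 10 < L) by (unfold L; lra).
  assert (HLU : L < U) by (unfold L, U; lra).
  assert (Hex : forall x, 1 < x -> ex_series (fun m => exp (- half_ln m * x))).
  { intros x Hx. eexists. now apply (is_series_half_real zeta). }
  assert (HsL : 1 < half_sum L).
  { apply half_sum_lower. apply Series_correct, Hex. lra. }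
  assert (HsU : half_sum U < 1).
  { apply half_sum_upper. apply Series_correct, Hex. lra. }
  set (F := fun x => (Rpower 2 x - 1) * (fst (zeta (RtoC x)) - 1) - 1).
  (* The two computed endpoints provide the sign change, and [L > 19/10] provides the margin
     required by [zeta_one_near]. *)
  destruct (IVT_interv (fun x => 1 - F x) L U) as (sigma0 & Hs0 & E0).
  { intros x Hx. apply continuity_pt_minus.
    - apply continuity_pt_const. intros ? ?. reflexivity.
    - apply continuity_pt_half_sum; [exact Hzeta|lra]. }
  { exact HLU. }
  { unfold F. rewrite <- half_sum_eq; auto; lra. }
  { unfold F. rewrite <- half_sum_eq; auto; lra. }
  assert (H1 : half_sum sigma0 = 1).
  { rewrite (half_sum_eq zeta); auto; [|lra]. unfold F in E0. lra. }
  exists sigma0. split; [|split].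
  - split.
    + split; [lra|]. apply half_sum_eq_1; auto. lra.
    + intros x [Hx Ex]. apply half_sum_eq_1 in Ex; auto.
      destruct (Rtotal_order sigma0 x) as [H|[H|H]]; [|exact H|].
      * apply half_sum_decreasing in H; [lra|apply Hex; lra..].
      * apply half_sum_decreasing in H; [lra|apply Hex; lra..].
  - apply is_lub_Rbar_unique. split.
    + intros sigma (t & _ & Ht). simpl.
      destruct (Rle_or_lt sigma sigma0) as [H|H]; [exact H|exfalso].
      assert (Hs : 1 < sigma) by lra.
      assert (Hre := is_series_half_re zeta sigma t Hzeta Hs).
      (* At a 1-point the real part of the series is -1, while its absolute value is at most
         [half_sum sigma], which is below [half_sum sigma0 = 1]. *)
      replace (fst (half_value zeta (sigma, t)) - 1) with (-1) in Hre.
      2: { unfold half_value. rewrite Ht. simpl. ring. }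
      apply is_series_unique in Hre.
      assert (Hle : Rabs (Series (fun m => exp (- half_ln m * sigma) * cos (half_ln m * t)))
        <= half_sum sigma).
      { apply Series_Rabs_le; [|now apply Hex]. intros m.
        rewrite Rabs_mult, Rabs_pos_eq by (left; apply exp_pos).
        rewrite <- (Rmult_1_r (exp (- half_ln m * sigma))) at 2.
        apply Rmult_le_compat_l; [left; apply exp_pos|apply Rabs_le, COS_bound]. }
      rewrite Hre, Rabs_left in Hle by lra.
      apply half_sum_decreasing in H; [lra|apply Hex; lra..].
    + intros l Hl.
      assert (Hnear : forall delta, 0 < delta -> exists x, sigma0 - delta <= x /\ Rbar_le x l).
      { intros delta Hdelta.
        destruct (zeta_one_near zeta sigma0 delta) as (x & t & Hx & Hx1 & Ht); auto; [lra|].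
        exists x. split; [exact Hx|]. apply Hl. exists t. split; [|exact Ht].
        intros E. apply (f_equal fst) in E. simpl in E. lra. }
      destruct l as [l| |]; simpl; auto.
      * destruct (Rle_or_lt sigma0 l) as [H|H]; [exact H|exfalso].
        destruct (Hnear ((sigma0 - l) / 2)) as (x & Hx & Hxl); [lra|]. simpl in Hxl. lra.
      (* The supremum is [m_infty] only for an empty set; a single 1-point excludes this. *)
      * destruct (Hnear 1) as (x & _ & Hxl); [lra|]. exact Hxl.
  - split; [lra|].
    (* Equality with the upper endpoint would contradict [half_sum U < 1]. *)
    destruct (Rle_lt_or_eq_dec sigma0 U (proj2 Hs0)) as [H|H]; [exact H|].
    rewrite H in H1. lra.
Qed.
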